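(* Let $\Omega\subset\mathbb{C}$ be a hyperbolic domain. Then the quasihyperbolic density $1/\delta_\Omega$ and the density $\overline{\eta}_\Omega$ are bi-Lipschitz equivalent; that is, for every $w\in\Omega$, $$\frac{1}{8\,\delta_\Omega(w)}\leq\overline{\eta}_\Omega(w)\leq\frac{2}{\delta_\Omega(w)}.$$
   Context: A domain is a nonempty open connected subset of $\mathbb{C}$; a domain $\Omega\subset\mathbb{C}$ is hyperbolic if its complement $\Omega^c=\mathbb{C}\setminus\Omega$ contains at least two points. $\mathbb{D}=\{z\in\mathbb{C}:|z|<1\}$ and $\mathbb{D}^*=\mathbb{D}\setminus\{0\}$. For $w\in\Omega$, $\delta_\Omega(w)=\inf_{p\in\Omega^c}|w-p|$; the quasihyperbolic density is $1/\delta_\Omega$. Hurwitz density: for a domain $\Omega\subsetneq\mathbb{C}$ and $w\in\Omega$, let $\mathcal{H}_0^w(\mathbb{D},\Omega)$ be the collection of all holomorphic functions $f:\mathbb{D}\to\Omega$ such that $f(0)=w$, $f(s)\neq w$ for all $s\in\mathbb{D}^*$, and $f'(0)>0$. Put $r_\Omega(w)=\max\{f'(0): f\in\mathcal{H}_0^w(\mathbb{D},\Omega)\}$ (the maximum is known to exist) and $\eta_\Omega(w)=2/r_\Omega(w)$. For a hyperbolic domain $\Omega$ and $w\in\Omega$, $$\overline{\eta}_\Omega(w)=\sup\,\eta_{\mathbb{C}\setminus\{w_1,w_2\}}(w),$$ where the supremum is taken over all pairs of distinct points $w_1,w_2\in\Omega^c$. *)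

(* Defs.v *)
From Stdlib Require Export Reals Lra.
From Coquelicot Require Export Coquelicot.
Open Scope R_scope.

Definition connected_set (Omega : C -> Prop) : Prop :=
  forall A B : C -> Prop,
    open A -> open B ->
    (forall z, Omega z -> A z \/ B z) ->
    (exists z, Omega z /\ A z) ->
    (exists z, Omega z /\ B z) ->
    exists z, Omega z /\ A z /\ B z.

Definition domain (Omega : C -> Prop) : Prop :=
  (exists z, Omega z) /\ open Omega /\ connected_set Omega.

Definition hyperbolic_domain (Omega : C -> Prop) : Prop :=
  domain Omega /\ exists a b : C, a <> b /\ ~ Omega a /\ ~ Omega b.

Definition unit_disk (z : C) : Prop := Cmod z < 1.

(** The modules are given explicitly so that the derivative is the complex one. *)
Definition is_Cderive (f : C -> C) (z l : C) : Prop :=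
  @is_derive C_AbsRing C_NormedModule f z l.

Definition holomorphic_on (D : C -> Prop) (f : C -> C) : Prop :=
  forall z, D z -> exists l : C, is_Cderive f z l.

(** Distance to the complement.  [real] only discards infinite values, which do
    not occur when the complement is nonempty. *)
Definition delta (Omega : C -> Prop) (w : C) : R :=
  real (Glb_Rbar (fun d => exists p : C, ~ Omega p /\ d = Cmod (w - p)%C)).

(** Functions on the disk are total functions whose values off the disk are
    irrelevant. *)
Definition hurwitz_family (Omega : C -> Prop) (w : C) (f : C -> C) : Prop :=
  holomorphic_on unit_disk f /\
  (forall z, unit_disk z -> Omega (f z)) /\
  f 0%C = w /\
  (forall s, unit_disk s -> s <> 0%C -> f s <> w) /\
  exists r : R, 0 < r /\ is_Cderive f 0%C (RtoC r).

Definition hurwitz_derivative (Omega : C -> Prop) (w : C) (r : R) : Prop :=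
  exists f, hurwitz_family Omega w f /\ is_Cderive f 0%C (RtoC r).

(** The maximum of [hurwitz_derivative Omega w], written as a supremum because
    [R] has no total maximum operator; see [hurwitz_radius_max]. *)
Definition hurwitz_radius (Omega : C -> Prop) (w : C) : R :=
  real (Lub_Rbar (hurwitz_derivative Omega w)).

Lemma hurwitz_radius_max (Omega : C -> Prop) (w : C) (m : R) :
  hurwitz_derivative Omega w m ->
  (forall r, hurwitz_derivative Omega w r -> r <= m) ->
  hurwitz_radius Omega w = m.
Proof.
intros Hm Hub.
unfold hurwitz_radius.
rewrite (is_lub_Rbar_unique _ (Finite m)); [reflexivity|].
split.
- intros r Hr. exact (Hub r Hr).
- intros b Hb. exact (Hb m Hm).
Qed.

Definition eta (Omega : C -> Prop) (w : C) : R := 2 / hurwitz_radius Omega w.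

Definition twice_punctured (w1 w2 : C) : C -> Prop :=
  fun z => z <> w1 /\ z <> w2.

(** Extended-real supremum: its finiteness is not presupposed. *)
Definition eta_bar (Omega : C -> Prop) (w : C) : Rbar :=
  Lub_Rbar (fun y => exists w1 w2 : C,
    w1 <> w2 /\ ~ Omega w1 /\ ~ Omega w2 /\
    y = eta (twice_punctured w1 w2) w).

(* Main.v *)
Require Import Defs.
From Stdlib Require Import Classical ClassicalEpsilon Lia.

(** The upper bound holds because the disk of radius [delta Omega w] about [w]
    lies in every twice punctured plane that competes, so that
    [z |-> w + delta Omega w * z] belongs to the Hurwitz family.

    The lower bound rests on Hurwitz's theorem ([hurwitz_bound]): if [f] maps the
    unit disk to the plane without the point [p], takes the value [w] only at
    [0], and [f'(0) = a > 0], then [a <= 16 * |w - p|].  Hence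
    [eta >= 1 / (8 * |w - p|)] for every punctured plane with [p] as a puncture,
    and [p] can be taken arbitrarily close to realizing the distance from [w] to
    the complement.

    The constant 16 is sharp and is attained by the elliptic modular function.
    The covering property of that function is replaced here by the Landen
    transformation, which is what its functional equation becomes when written
    in terms of [f].  After an affine change of variable let [f] vanish only at
    [0], to order [N], and omit [1]; write [f = z ^ N * k] with [k] nonvanishing.
    The function [1 - f] has a holomorphic square root [g] with [g(0) = 1], and
    [h = (1 - g) / (1 + g)] again vanishes only at [0] and omits [1] and [-1].
    So [h ^ 2] is of the same kind with [2 N] in place of [N], and its
    coefficient is [k(0) ^ 2 / 16].  The circular mean of [ln (1 + |f|)] does not
    increase in this passage: pointwise it grows by at most
    [2 * ln 2 - 2 * ln |1 + g|] ([landen_pointwise]), which has mean [0] because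
    [ln |1 + g|] is harmonic with value [ln 2] at [0].

    On the other hand the mean of [ln |k|] is [ln |k(0)|], so that
    [ln |k(0)| + N * ln r] is at most the mean of [ln (1 + |f|)] over the circle
    of radius [r] ([growth_bound]).  Applying this after [n] transformations to a
    function with [N = 1] gives
    [2 ^ n * (ln |k(0)| - ln 16 + ln r) <= const] with a constant that does not
    depend on [n].  Letting [n] tend to infinity and then [r] to [1] yields
    [|k(0)| <= 16].

    Two facts of complex analysis are needed for functions that are merely
    complex differentiable at each point.  Nonvanishing functions on a disk have
    logarithms on smaller disks ([exists_log]): these are sums of principal
    logarithms along rays, with no integration involved.  And [ln |F|] has the mean
    value property ([mean_ln_mod]): this is Goursat's bisection argument
    ([flux_eq_0]) in logarithmic polar coordinates.  Those coordinates never
    meet the point [0], so differentiability is only asked away from [0]; this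
    lets the quotient [f z / z ^ N] be used without removing its
    singularity. *)

(** * Continuity and complex differentiability of maps of the plane *)

(** The plane carries the product uniform structure and that of the modulus;
    they have the same neighbourhoods ([near_Cmod]). *)
Definition ccont (f : C -> C) (z : C) : Prop :=
  @continuous C_UniformSpace C_UniformSpace f z.

Lemma near_Cmod (z : C) (P : C -> Prop) :
  @locally C_UniformSpace z P <->
  exists d, 0 < d /\ forall w, Cmod (w - z) < d -> P w.
Proof.
split.
- intros H. apply locally_C in H. destruct H as [d Hd].
  exists d. split; [apply cond_pos|]. intros w Hw. apply Hd. exact Hw.
- intros [d [Hd H]]. apply locally_C. exists (mkposreal d Hd).
  intros w Hw. apply H. exact Hw.
Qed.

Lemma ccont_Cmod (f : C -> C) (z : C) :
  ccont f z <->
  forall eps, 0 < eps -> exists d, 0 < d /\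
    forall w, Cmod (w - z) < d -> Cmod (f w - f z) < eps.
Proof.
split.
- intros H eps He.
  apply (near_Cmod z (fun w => Cmod (f w - f z) < eps)).
  apply (H (fun y => Cmod (y - f z) < eps)).
  apply near_Cmod. exists eps. split; [exact He|]. tauto.
- intros H P HP. apply near_Cmod in HP. destruct HP as [e [He HP]].
  destruct (H e He) as [d [Hd Hw]].
  change (@locally C_UniformSpace z (fun w => P (f w))).
  apply near_Cmod. exists d. split; [exact Hd|].
  intros w Hz. apply HP, Hw, Hz.
Qed.

Lemma continuous_pair (U : UniformSpace) (f g : U -> R) (x : U) :
  continuous f x -> continuous g x ->
  @continuous U C_UniformSpace (fun u => (f u, g u)) x.
Proof.
intros Hf Hg P [e HP].
assert (H1 : locally x (fun u => ball (f x) e (f u))).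
{ apply Hf. exists e. tauto. }
assert (H2 : locally x (fun u => ball (g x) e (g u))).
{ apply Hg. exists e. tauto. }
change (locally x (fun u => P (f u, g u))).
apply (filter_imp (fun u => ball (f x) e (f u) /\ ball (g x) e (g u))).
- intros u [A B]. apply HP. split; assumption.
- apply filter_and; assumption.
Qed.

Lemma continuous_Re (z : C) : @continuous C_UniformSpace R_UniformSpace Re z.
Proof. apply (@continuous_fst R_UniformSpace R_UniformSpace). Qed.

Lemma continuous_Im (z : C) : @continuous C_UniformSpace R_UniformSpace Im z.
Proof. apply (@continuous_snd R_UniformSpace R_UniformSpace). Qed.

Lemma continuous_Cmod (z : C) : @continuous C_UniformSpace R_UniformSpace Cmod z.
Proof.
intros P [e HP]. change (@locally C_UniformSpace z (fun w => P (Cmod w))).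
apply near_Cmod. exists e. split; [apply cond_pos|].
intros w Hw. apply HP. change (Rabs (Cmod w - Cmod z) < e).
assert (A := Cmod_triangle (w - z) z). assert (B := Cmod_triangle (z - w) w).
replace (w - z + z)%C with w in A by ring.
replace (z - w + w)%C with z in B by ring.
replace (z - w)%C with (- (w - z))%C in B by ring. rewrite Cmod_opp in B.
apply Rabs_def1; lra.
Qed.

Lemma ccont_near (f g : C -> C) (z : C) (d : R) :
  0 < d -> (forall w, Cmod (w - z) < d -> f w = g w) -> ccont f z -> ccont g z.
Proof.
intros Hd H. apply continuous_ext_loc.
apply near_Cmod. exists d. split; [exact Hd|exact H].
Qed.

Lemma ccont_const (c z : C) : ccont (fun _ => c) z.
Proof. apply continuous_const. Qed.

Lemma ccont_id (z : C) : ccont (fun w => w) z.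
Proof. apply continuous_id. Qed.

Lemma ccont_comp (f g : C -> C) (z : C) :
  ccont f z -> ccont g (f z) -> ccont (fun w => g (f w)) z.
Proof. apply continuous_comp. Qed.

Lemma ccont_plus (f g : C -> C) (z : C) :
  ccont f z -> ccont g z -> ccont (fun w => f w + g w)%C z.
Proof. apply (@continuous_plus C_UniformSpace C_AbsRing C_NormedModule). Qed.

Lemma ccont_opp (f : C -> C) (z : C) :
  ccont f z -> ccont (fun w => - f w)%C z.
Proof. apply (@continuous_opp C_UniformSpace C_AbsRing C_NormedModule). Qed.

Lemma ccont_minus (f g : C -> C) (z : C) :
  ccont f z -> ccont g z -> ccont (fun w => f w - g w)%C z.
Proof. apply (@continuous_minus C_UniformSpace C_AbsRing C_NormedModule). Qed.

Lemma ccont_mult (f g : C -> C) (z : C) :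
  ccont f z -> ccont g z -> ccont (fun w => f w * g w)%C z.
Proof.
intros Hf Hg.
assert (Hf1 := continuous_comp f Re z Hf (continuous_Re _)).
assert (Hf2 := continuous_comp f Im z Hf (continuous_Im _)).
assert (Hg1 := continuous_comp g Re z Hg (continuous_Re _)).
assert (Hg2 := continuous_comp g Im z Hg (continuous_Im _)).
apply continuous_pair.
- apply (@continuous_minus C_UniformSpace R_AbsRing R_NormedModule);
  apply (@continuous_mult C_UniformSpace R_AbsRing); assumption.
- apply (@continuous_plus C_UniformSpace R_AbsRing R_NormedModule);
  apply (@continuous_mult C_UniformSpace R_AbsRing); assumption.
Qed.

Lemma ccont_inv (f : C -> C) (z : C) :
  ccont f z -> f z <> 0 -> ccont (fun w => / f w)%C z.
Proof.
intros Hf Hz.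
assert (Hf1 := continuous_comp f Re z Hf (continuous_Re _)).
assert (Hf2 := continuous_comp f Im z Hf (continuous_Im _)).
assert (Hn : continuous (fun w : C_UniformSpace => / (Re (f w) ^ 2 + Im (f w) ^ 2)) z).
{ apply (continuous_comp (fun w : C_UniformSpace => Re (f w) ^ 2 + Im (f w) ^ 2) Rinv).
  - apply (continuous_ext (fun w : C_UniformSpace =>
      Re (f w) * Re (f w) + Im (f w) * Im (f w))).
    { intros w. change (Re (f w) * Re (f w) + Im (f w) * Im (f w)
        = Re (f w) ^ 2 + Im (f w) ^ 2). ring. }
    apply (@continuous_plus C_UniformSpace R_AbsRing R_NormedModule);
    apply (@continuous_mult C_UniformSpace R_AbsRing); assumption.
  - apply continuous_Rinv. rewrite <- Cmod2_alt.
    apply Cmod_gt_0 in Hz. nra. }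
apply (continuous_pair C_UniformSpace
  (fun w => Re (f w) * / (Re (f w) ^ 2 + Im (f w) ^ 2))
  (fun w => - Im (f w) * / (Re (f w) ^ 2 + Im (f w) ^ 2))).
- apply (@continuous_mult C_UniformSpace R_AbsRing); assumption.
- apply (@continuous_mult C_UniformSpace R_AbsRing); try assumption.
  apply (@continuous_opp C_UniformSpace R_AbsRing R_NormedModule). assumption.
Qed.

Lemma ccont_div (f g : C -> C) (z : C) :
  ccont f z -> ccont g z -> g z <> 0 -> ccont (fun w => f w / g w)%C z.
Proof. intros Hf Hg Hz. apply ccont_mult; [|apply ccont_inv]; assumption. Qed.

Lemma ccont_neq (f : C -> C) (z c : C) :
  ccont f z -> f z <> c -> exists d, 0 < d /\ forall w, Cmod (w - z) < d -> f w <> c.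
Proof.
intros Hf Hc.
assert (Hp : 0 < Cmod (f z - c)).
{ apply Cmod_gt_0. intro H. apply Hc.
  replace (f z) with (f z - c + c)%C by ring. rewrite H. ring. }
destruct (proj1 (ccont_Cmod f z) Hf _ Hp) as [d [Hd H]].
exists d. split; [exact Hd|]. intros w Hw E. specialize (H w Hw).
rewrite E in H. replace (c - f z)%C with (- (f z - c))%C in H by ring.
rewrite Cmod_opp in H. lra.
Qed.

(** Caratheodory's form of differentiability: with a difference quotient
    continuous at [z], the rules of differentiation are identities between
    quotients. *)
Definition cdiff (f : C -> C) (z : C) : Prop :=
  exists q, ccont q z /\ forall w, (f w - f z = q w * (w - z))%C.

Lemma C_eq_dec (z w : C) : {z = w} + {z <> w}.
Proof.
destruct z as [a b], w as [c d].
destruct (Req_EM_T a c) as [->|H]; [destruct (Req_EM_T b d) as [->|H]|].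
- left; reflexivity.
- right; intro E; apply H; injection E; auto.
- right; intro E; apply H; injection E; auto.
Defined.

Lemma Cminus_neq_0 (z w : C) : z <> w -> (z - w)%C <> 0.
Proof.
intros H E. apply H. replace z with (z - w + w)%C by ring. rewrite E. ring.
Qed.

(** Far from [z] the difference quotient itself serves, so [q] only matters
    near [z]. *)
Lemma cdiff_local (f q : C -> C) (z : C) (d : R) :
  0 < d -> ccont q z ->
  (forall w, Cmod (w - z) < d -> (f w - f z = q w * (w - z))%C) -> cdiff f z.
Proof.
intros Hd Hq H.
exists (fun w => if C_eq_dec w z then q z else ((f w - f z) / (w - z))%C).
split.
- apply (ccont_near q _ z d Hd); [|exact Hq].
  intros w Hw. destruct (C_eq_dec w z) as [->|N]; [reflexivity|].
  rewrite (H w Hw). field. apply Cminus_neq_0, N.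
- intros w. destruct (C_eq_dec w z) as [->|N]; [ring|].
  field. apply Cminus_neq_0, N.
Qed.

Lemma cdiff_near (f g : C -> C) (z : C) (d : R) :
  0 < d -> (forall w, Cmod (w - z) < d -> f w = g w) -> cdiff f z -> cdiff g z.
Proof.
intros Hd H [q [Hq E]].
apply (cdiff_local g q z d Hd Hq). intros w Hw.
rewrite <- (H w Hw), <- (H z).
- apply E.
- replace (z - z)%C with (RtoC 0) by ring. rewrite Cmod_0. exact Hd.
Qed.

Lemma cdiff_ccont (f : C -> C) (z : C) : cdiff f z -> ccont f z.
Proof.
intros [q [Hq E]].
apply (ccont_near (fun w => f z + q w * (w - z))%C f z 1 Rlt_0_1).
- intros w _. rewrite <- E. ring.
- apply ccont_plus; [apply ccont_const|]. apply ccont_mult; [exact Hq|].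
  apply ccont_minus; [apply ccont_id|apply ccont_const].
Qed.

Lemma cdiff_const (c z : C) : cdiff (fun _ => c) z.
Proof. exists (fun _ => 0%C). split; [apply ccont_const|]. intros; ring. Qed.

Lemma cdiff_id (z : C) : cdiff (fun w => w) z.
Proof. exists (fun _ => 1%C). split; [apply ccont_const|]. intros; ring. Qed.

Lemma cdiff_plus (f g : C -> C) (z : C) :
  cdiff f z -> cdiff g z -> cdiff (fun w => f w + g w)%C z.
Proof.
intros [p [Hp Ep]] [q [Hq Eq]]. exists (fun w => p w + q w)%C.
split; [apply ccont_plus; assumption|]. intros w.
replace (f w + g w - (f z + g z))%C with ((f w - f z) + (g w - g z))%C by ring.
rewrite Ep, Eq. ring.
Qed.

Lemma cdiff_opp (f : C -> C) (z : C) : cdiff f z -> cdiff (fun w => - f w)%C z.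
Proof.
intros [p [Hp Ep]]. exists (fun w => - p w)%C.
split; [apply ccont_opp; assumption|]. intros w.
replace (- f w - - f z)%C with (- (f w - f z))%C by ring. rewrite Ep. ring.
Qed.

Lemma cdiff_minus (f g : C -> C) (z : C) :
  cdiff f z -> cdiff g z -> cdiff (fun w => f w - g w)%C z.
Proof. intros Hf Hg. apply cdiff_plus; [|apply cdiff_opp]; assumption. Qed.

Lemma cdiff_mult (f g : C -> C) (z : C) :
  cdiff f z -> cdiff g z -> cdiff (fun w => f w * g w)%C z.
Proof.
intros Hf Hg. assert (Cg := cdiff_ccont g z Hg).
destruct Hf as [p [Hp Ep]], Hg as [q [Hq Eq]].
exists (fun w => p w * g w + f z * q w)%C. split.
- apply ccont_plus; apply ccont_mult; try assumption. apply ccont_const.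
- intros w.
  replace (f w * g w - f z * g z)%C
    with ((f w - f z) * g w + f z * (g w - g z))%C by ring.
  rewrite Ep, Eq. ring.
Qed.

Lemma cdiff_inv (f : C -> C) (z : C) :
  cdiff f z -> f z <> 0 -> cdiff (fun w => / f w)%C z.
Proof.
intros Hf Hz. assert (Cf := cdiff_ccont f z Hf).
destruct (ccont_neq f z 0 Cf Hz) as [d [Hd Hn]].
destruct Hf as [p [Hp Ep]].
apply (cdiff_local _ (fun w => - p w * (/ f w * / f z))%C z d Hd).
- apply ccont_mult; [apply ccont_opp; assumption|].
  apply ccont_mult; [apply ccont_inv; assumption|apply ccont_const].
- intros w Hw.
  replace (- p w * (/ f w * / f z) * (w - z))%C
    with (- (p w * (w - z)) * (/ f w * / f z))%C by ring.
  rewrite <- Ep. field. split; [exact Hz|apply Hn, Hw].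
Qed.

Lemma cdiff_div (f g : C -> C) (z : C) :
  cdiff f z -> cdiff g z -> g z <> 0 -> cdiff (fun w => f w / g w)%C z.
Proof. intros Hf Hg Hz. apply cdiff_mult; [|apply cdiff_inv]; assumption. Qed.

Lemma cdiff_comp (f g : C -> C) (z : C) :
  cdiff f z -> cdiff g (f z) -> cdiff (fun w => g (f w)) z.
Proof.
intros Hf Hg. assert (Cf := cdiff_ccont f z Hf).
destruct Hf as [p [Hp Ep]], Hg as [q [Hq Eq]].
exists (fun w => q (f w) * p w)%C. split.
- apply ccont_mult; [|exact Hp]. apply ccont_comp; assumption.
- intros w. rewrite Eq, Ep. ring.
Qed.

Lemma linear_approx_quotient (f : C -> C) (z l : C) :
  (forall eps, 0 < eps -> exists d, 0 < d /\ forall w, Cmod (w - z) < d ->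
     Cmod (f w - f z - (w - z) * l) <= eps * Cmod (w - z)) ->
  exists q, ccont q z /\ q z = l /\ forall w, (f w - f z = q w * (w - z))%C.
Proof.
intros H.
exists (fun w => if C_eq_dec w z then l else ((f w - f z) / (w - z))%C).
split; [|split].
- apply ccont_Cmod. intros eps He.
  destruct (H (eps / 2)) as [d [Hd Hw]]; [lra|].
  exists d. split; [exact Hd|]. intros w Hz. specialize (Hw w Hz).
  destruct (C_eq_dec z z) as [_|N]; [|contradiction].
  destruct (C_eq_dec w z) as [E|N].
  + replace (l - l)%C with (RtoC 0) by ring. rewrite Cmod_0. exact He.
  + assert (Hp : 0 < Cmod (w - z)) by (apply Cmod_gt_0, Cminus_neq_0, N).
    replace ((f w - f z) / (w - z) - l)%C
      with ((f w - f z - (w - z) * l) / (w - z))%C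
      by (field; apply Cminus_neq_0, N).
    rewrite Cmod_div by (apply Cminus_neq_0, N).
    apply Rle_lt_trans with (eps / 2); [|lra].
    apply (Rmult_le_reg_r (Cmod (w - z))); [exact Hp|].
    unfold Rdiv at 1. rewrite Rmult_assoc, Rinv_l by lra. lra.
- destruct (C_eq_dec z z) as [_|N]; [reflexivity|contradiction].
- intros w. destruct (C_eq_dec w z) as [->|N]; [ring|].
  field. apply Cminus_neq_0, N.
Qed.

(** Unlike [cdiff], this keeps track of the value of the derivative. *)
Lemma is_Cderive_quotient (f : C -> C) (z l : C) :
  is_Cderive f z l ->
  exists q, ccont q z /\ q z = l /\ forall w, (f w - f z = q w * (w - z))%C.
Proof.
intros [_ H]. apply linear_approx_quotient. intros eps He.
destruct (H z (fun P HP => HP) (mkposreal eps He)) as [d Hd].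
exists d. split; [apply cond_pos|]. exact Hd.
Qed.

Lemma is_Cderive_cdiff (f : C -> C) (z l : C) : is_Cderive f z l -> cdiff f z.
Proof.
intros H. destruct (is_Cderive_quotient f z l H) as [q [Hq [_ E]]].
exists q. split; assumption.
Qed.


(** * The divergence theorem on rectangles without continuity of the derivative *)

(** The field [(P, Q)] is totally differentiable at the point, with derivative of
    trace [0]. *)
Definition solenoidal_at (P Q : R -> R -> R) (x0 y0 : R) : Prop :=
  exists al be ga, forall eps, 0 < eps -> exists d, 0 < d /\
    forall x y, Rabs (x - x0) < d -> Rabs (y - y0) < d ->
      Rabs (P x y - P x0 y0 - (al * (x - x0) + be * (y - y0)))
        <= eps * (Rabs (x - x0) + Rabs (y - y0)) /\
      Rabs (Q x y - Q x0 y0 - (ga * (x - x0) - al * (y - y0)))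
        <= eps * (Rabs (x - x0) + Rabs (y - y0)).

Definition flux (P Q : R -> R -> R) (a b c d : R) : R :=
  (RInt (P b) c d - RInt (P a) c d) +
  (RInt (fun x => Q x d) a b - RInt (fun x => Q x c) a b).

Lemma lipschitz_continuous (f : R -> R) (x0 d M : R) :
  0 < d ->
  (forall x, Rabs (x - x0) < d -> Rabs (f x - f x0) <= M * Rabs (x - x0)) ->
  continuous f x0.
Proof.
intros Hd H P [e HP].
assert (HM : 0 < Rabs M + 1) by (assert (A := Rabs_pos M); lra).
assert (Hm : 0 < Rmin d (e / (Rabs M + 1))).
{ apply Rmin_pos; [exact Hd|]. apply Rdiv_lt_0_compat; [apply cond_pos|exact HM]. }
exists (mkposreal _ Hm). intros x Hx. apply HP.
change (Rabs (x - x0) < Rmin d (e / (Rabs M + 1))) in Hx.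
change (Rabs (f x - f x0) < e).
assert (H1 := Rmin_l d (e / (Rabs M + 1))).
assert (H2 := Rmin_r d (e / (Rabs M + 1))).
apply Rle_lt_trans with (1 := H x (Rlt_le_trans _ _ _ Hx H1)).
apply Rle_lt_trans with ((Rabs M + 1) * Rabs (x - x0)).
- apply Rmult_le_compat_r; [apply Rabs_pos|]. assert (A := Rle_abs M); lra.
- replace (pos e) with ((Rabs M + 1) * (e / (Rabs M + 1))) by (field; lra).
  apply Rmult_lt_compat_l; lra.
Qed.

Lemma solenoidal_continuous (P Q : R -> R -> R) (x0 y0 : R) :
  solenoidal_at P Q x0 y0 ->
  continuous (P x0) y0 /\ continuous (fun x => Q x y0) x0.
Proof.
intros [al [be [ga H]]]. destruct (H 1 Rlt_0_1) as [d [Hd Hq]].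
split.
- apply (lipschitz_continuous _ _ d (Rabs be + 1) Hd). intros y Hy.
  assert (Z : Rabs (x0 - x0) = 0) by (rewrite Rminus_diag; apply Rabs_R0).
  destruct (Hq x0 y) as [A _]; [lra|exact Hy|]. rewrite Z, Rminus_diag in A.
  replace (P x0 y - P x0 y0)
    with ((P x0 y - P x0 y0 - (al * 0 + be * (y - y0))) + be * (y - y0)) by ring.
  apply Rle_trans with (1 := Rabs_triang _ _). rewrite Rabs_mult. lra.
- apply (lipschitz_continuous _ _ d (Rabs ga + 1) Hd). intros x Hx.
  assert (Z : Rabs (y0 - y0) = 0) by (rewrite Rminus_diag; apply Rabs_R0).
  destruct (Hq x y0) as [_ A]; [exact Hx|lra|]. rewrite Z, Rminus_diag in A.
  replace (Q x y0 - Q x0 y0)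
    with ((Q x y0 - Q x0 y0 - (ga * (x - x0) - al * 0)) + ga * (x - x0)) by ring.
  apply Rle_trans with (1 := Rabs_triang _ _). rewrite Rabs_mult. lra.
Qed.

Lemma ex_RInt_cont (f : R -> R) (a b : R) :
  a <= b -> (forall x, a <= x <= b -> continuous f x) -> ex_RInt f a b.
Proof.
intros Hab H. apply (ex_RInt_continuous (V := R_CompleteNormedModule)).
rewrite Rmin_left, Rmax_right by exact Hab. exact H.
Qed.

Lemma RInt_near_const (f : R -> R) (a b k M : R) :
  a <= b -> ex_RInt f a b ->
  (forall x, a <= x <= b -> Rabs (f x - k) <= M) ->
  Rabs (RInt f a b - (b - a) * k) <= (b - a) * M.
Proof.
intros Hab Hf H.
replace (RInt f a b - (b - a) * k) with (RInt (fun x => f x - k) a b).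
- apply abs_RInt_le_const; [exact Hab| |exact H].
  apply (ex_RInt_minus f (fun _ => k)); [exact Hf|apply ex_RInt_const].
- rewrite (RInt_minus f (fun _ => k)); [|exact Hf|apply ex_RInt_const].
  rewrite (RInt_const a b k). reflexivity.
Qed.

Lemma Rabs_between (a b x y : R) : a <= x <= b -> a <= y <= b -> Rabs (x - y) <= b - a.
Proof. intros. apply Rabs_le. lra. Qed.

Section Rectangle.

Variables (P Q : R -> R -> R) (a b c d : R).
Hypothesis Hsol : forall x y, a <= x <= b -> c <= y <= d -> solenoidal_at P Q x y.

Let exP (x u v : R) : a <= x <= b -> c <= u -> u <= v -> v <= d -> ex_RInt (P x) u v.
Proof.
intros Hx Hu Huv Hv. apply ex_RInt_cont; [exact Huv|]. intros y Hy.
apply (solenoidal_continuous P Q x y), Hsol; lra.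
Qed.

Let exQ (y u v : R) : c <= y <= d -> a <= u -> u <= v -> v <= b ->
  ex_RInt (fun x => Q x y) u v.
Proof.
intros Hx Hu Huv Hv. apply ex_RInt_cont; [exact Huv|]. intros x Hy.
apply (solenoidal_continuous P Q x y), Hsol; lra.
Qed.

Lemma flux_quarters (u s v t : R) :
  a <= u -> 0 <= s -> u + s <= b -> c <= v -> 0 <= t -> v + t <= d ->
  flux P Q u (u + s) v (v + t) =
  flux P Q u (u + s / 2) v (v + t / 2) +
  flux P Q (u + s / 2) (u + s) v (v + t / 2) +
  flux P Q u (u + s / 2) (v + t / 2) (v + t) +
  flux P Q (u + s / 2) (u + s) (v + t / 2) (v + t).
Proof.
intros. unfold flux.
assert (CP : forall x, a <= x <= b ->
  RInt (P x) v (v + t) = RInt (P x) v (v + t / 2) + RInt (P x) (v + t / 2) (v + t)).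
{ intros x Hx. symmetry. apply (RInt_Chasles (P x)); apply exP; lra. }
assert (CQ : forall y, c <= y <= d ->
  RInt (fun x => Q x y) u (u + s) =
  RInt (fun x => Q x y) u (u + s / 2) + RInt (fun x => Q x y) (u + s / 2) (u + s)).
{ intros y Hy. symmetry. apply (RInt_Chasles (fun x => Q x y)); apply exQ; lra. }
rewrite !CP, !CQ by lra. ring.
Qed.

(** The divergence of the affine approximation vanishes, so only the error
    term contributes to the flux through a small rectangle. *)
Lemma flux_small (x0 y0 eps : R) :
  a <= x0 <= b -> c <= y0 <= d -> 0 < eps ->
  exists del, 0 < del /\ forall u s v t,
    a <= u -> u <= x0 <= u + s -> u + s <= b ->
    c <= v -> v <= y0 <= v + t -> v + t <= d ->
    s < del -> t < del ->
    Rabs (flux P Q u (u + s) v (v + t)) <= 2 * eps * (s + t) ^ 2.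
Proof.
intros Hx0 Hy0 He.
destruct (Hsol x0 y0 Hx0 Hy0) as [al [be [ga H]]].
destruct (H eps He) as [del [Hdel Happ]].
exists del. split; [exact Hdel|]. intros u s v t U1 U2 U3 V1 V2 V3 Hs Ht.
assert (E : forall x y, u <= x <= u + s -> v <= y <= v + t ->
  Rabs (P x y - P x0 y0 - (al * (x - x0) + be * (y - y0))) <= eps * (s + t) /\
  Rabs (Q x y - Q x0 y0 - (ga * (x - x0) - al * (y - y0))) <= eps * (s + t)).
{ intros x y Hx Hy.
  assert (A1 := Rabs_between u (u + s) x x0 Hx U2).
  assert (A2 := Rabs_between v (v + t) y y0 Hy V2).
  destruct (Happ x y) as [B1 B2]; [lra|lra|].
  assert (eps * (Rabs (x - x0) + Rabs (y - y0)) <= eps * (s + t))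
    by (apply Rmult_le_compat_l; lra).
  split; lra. }
assert (IP : Rabs (RInt (fun y => P (u + s) y - P u y) v (v + t)
               - (v + t - v) * (al * s)) <= (v + t - v) * (2 * (eps * (s + t)))).
{ apply RInt_near_const; [lra| |].
  - apply (ex_RInt_minus (P (u + s)) (P u)); apply exP; lra.
  - intros y Hy. destruct (E (u + s) y) as [B1 _]; [lra|lra|].
    destruct (E u y) as [B2 _]; [lra|lra|].
    replace (P (u + s) y - P u y - al * s) with
      ((P (u + s) y - P x0 y0 - (al * (u + s - x0) + be * (y - y0))) -
       (P u y - P x0 y0 - (al * (u - x0) + be * (y - y0)))) by ring.
    apply Rle_trans with (1 := Rabs_triang _ _). rewrite Rabs_Ropp. lra. }
assert (IQ : Rabs (RInt (fun x => Q x (v + t) - Q x v) u (u + s)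
               - (u + s - u) * (- al * t)) <= (u + s - u) * (2 * (eps * (s + t)))).
{ apply RInt_near_const; [lra| |].
  - apply (ex_RInt_minus (fun x => Q x (v + t)) (fun x => Q x v)); apply exQ; lra.
  - intros x Hx. destruct (E x (v + t)) as [_ B1]; [lra|lra|].
    destruct (E x v) as [_ B2]; [lra|lra|].
    replace (Q x (v + t) - Q x v - - al * t) with
      ((Q x (v + t) - Q x0 y0 - (ga * (x - x0) - al * (v + t - y0))) -
       (Q x v - Q x0 y0 - (ga * (x - x0) - al * (v - y0)))) by ring.
    apply Rle_trans with (1 := Rabs_triang _ _). rewrite Rabs_Ropp. lra. }
rewrite (RInt_minus (P (u + s)) (P u)) in IP by (apply exP; lra).
rewrite (RInt_minus (fun x => Q x (v + t)) (fun x => Q x v)) in IQ by (apply exQ; lra).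
unfold flux. unfold minus, plus, opp in IP, IQ; simpl in IP, IQ.
apply Rabs_le_between in IP. apply Rabs_le_between in IQ.
apply Rabs_le. split; nra.
Qed.

Let s := b - a.
Let t := d - c.

(* A cell of generation [n] is given by its lower left corner; [step] selects a
   quarter of it that carries at least a quarter of its flux. *)

Let cell (n : nat) (p : R * R) : R :=
  flux P Q (fst p) (fst p + s / 2 ^ n) (snd p) (snd p + t / 2 ^ n).

Let step (n : nat) (p : R * R) : R * R :=
  let u := fst p in let v := snd p in
  let u' := u + s / 2 ^ S n in let v' := v + t / 2 ^ S n in
  let big q := Rle_dec (Rabs (cell n p) / 4) (Rabs (cell (S n) q)) in
  if big (u, v) then (u, v) else
  if big (u', v) then (u', v) else
  if big (u, v') then (u, v') else (u', v').

Let corner : nat -> R * R :=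
  fix corner n := match n with O => (a, c) | S m => step m (corner m) end.

(** Goursat's argument: one of four quarters carries at least a quarter of the
    flux, so nested quarters carry a flux of at least a constant times their
    area, whereas differentiability at their common point makes the flux
    negligible with respect to the area. *)
Lemma flux_eq_0 : a <= b -> c <= d -> flux P Q a b c d = 0.
Proof.
intros Hab Hcd.
assert (Hs : 0 <= s) by (unfold s; lra).
assert (Ht : 0 <= t) by (unfold t; lra).
assert (P2 : forall n, 0 < 2 ^ n) by (intro; apply pow_lt; lra).
assert (Sn : forall n z, z / 2 ^ S n = z / 2 ^ n / 2)
  by (intros n z; simpl; field; assert (A := P2 n); lra).
assert (Hpos : forall n z, 0 <= z -> 0 <= z / 2 ^ n).
{ intros n z Hz. apply Rmult_le_pos; [exact Hz|].
  apply Rlt_le, Rinv_0_lt_compat, P2. }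
assert (Hstep : forall n p,
  (fst (step n p) = fst p \/ fst (step n p) = fst p + s / 2 ^ S n) /\
  (snd (step n p) = snd p \/ snd (step n p) = snd p + t / 2 ^ S n)).
{ intros n [u v]. unfold step. cbv zeta.
  repeat destruct Rle_dec; cbn [fst snd]; auto. }
assert (Hin : forall n,
  a <= fst (corner n) /\ fst (corner n) + s / 2 ^ n <= b /\
  c <= snd (corner n) /\ snd (corner n) + t / 2 ^ n <= d).
{ induction n as [|n IH].
  - cbn [corner fst snd pow]. unfold s, t. lra.
  - change (corner (S n)) with (step n (corner n)).
    destruct (Hstep n (corner n)) as [A B].
    rewrite (Sn n s) in *. rewrite (Sn n t) in *.
    assert (A1 := Hpos n s Hs). assert (A2 := Hpos n t Ht).
    destruct A as [-> | ->], B as [-> | ->]; lra. }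
assert (Hbig : forall n, Rabs (flux P Q a b c d) / 4 ^ n <= Rabs (cell n (corner n))).
{ induction n as [|n IH].
  - unfold cell. cbn [corner fst snd pow]. unfold s, t.
    replace (a + (b - a) / 1) with b by field.
    replace (c + (d - c) / 1) with d by field. lra.
  - change (corner (S n)) with (step n (corner n)).
    apply Rle_trans with (Rabs (cell n (corner n)) / 4).
    { simpl pow. assert (0 < 4 ^ n) by (apply pow_lt; lra).
      replace (Rabs (flux P Q a b c d) / (4 * 4 ^ n))
        with (Rabs (flux P Q a b c d) / 4 ^ n / 4) by (field; lra). lra. }
    clear IH. destruct (Hin n) as [I1 [I2 [I3 I4]]].
    destruct (corner n) as [u v] eqn:Ec. cbn [fst snd] in *.
    unfold step. cbv zeta. cbn [fst snd].
    destruct Rle_dec as [H1|H1]; [exact H1|].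
    destruct Rle_dec as [H2|H2]; [exact H2|].
    destruct Rle_dec as [H3|H3]; [exact H3|].
    apply Rnot_le_lt in H1, H2, H3.
    assert (A1 := Hpos n s Hs). assert (A2 := Hpos n t Ht).
    assert (F := flux_quarters u (s / 2 ^ n) v (t / 2 ^ n) I1 A1 I2 I3 A2 I4).
    unfold cell in *. cbn [fst snd] in *. rewrite !Sn in *.
    replace (u + s / 2 ^ n / 2 + s / 2 ^ n / 2) with (u + s / 2 ^ n) in * by (field; apply Rgt_not_eq, P2).
    replace (v + t / 2 ^ n / 2 + t / 2 ^ n / 2) with (v + t / 2 ^ n) in * by (field; apply Rgt_not_eq, P2).
    match type of F with _ = ?f1 + ?f2 + ?f3 + ?f4 =>
      set (g1 := f1) in *; set (g2 := f2) in *; set (g3 := f3) in *;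
      set (g4 := f4) in * end.
    rewrite F in *.
    assert (T1 := Rabs_triang (g1 + g2 + g3) g4).
    assert (T2 := Rabs_triang (g1 + g2) g3).
    assert (T3 := Rabs_triang g1 g2). lra. }
(* The lower ends of nested intervals increase to a point common to all. *)
assert (Hlim : forall (f : nat -> R) (z lo hi : R), 0 <= z ->
  (forall n, f (S n) = f n \/ f (S n) = f n + z / 2 ^ S n) ->
  (forall n, lo <= f n /\ f n + z / 2 ^ n <= hi) ->
  exists x, forall n, f n <= x <= f n + z / 2 ^ n).
{ intros f z lo hi Hz Hf Hb.
  assert (Mon : forall n k, f n <= f (n + k)%nat /\
    f (n + k)%nat + z / 2 ^ (n + k) <= f n + z / 2 ^ n).
  { intros n k. induction k as [|k IH].
    - rewrite Nat.add_0_r. lra.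
    - rewrite Nat.add_succ_r. assert (A := Hpos (n + k)%nat z Hz).
      assert (B := Hf (n + k)%nat).
      rewrite (Sn (n + k)%nat z) in *. destruct B as [-> | ->]; lra. }
  destruct (completeness (fun y => exists n, y = f n)) as [x [Hx1 Hx2]].
  - exists hi. intros y [n ->]. assert (A := Hpos n z Hz). destruct (Hb n). lra.
  - exists (f O), O. reflexivity.
  - exists x. intros n. split; [apply Hx1; exists n; reflexivity|].
    apply Hx2. intros y [m ->].
    assert (A := Hpos m z Hz). assert (B := Hpos (n + m)%nat z Hz).
    destruct (Mon n m) as [_ M1]. destruct (Mon m n) as [M2 _].
    rewrite Nat.add_comm in M2. lra. }
destruct (Hlim (fun n => fst (corner n)) s a b Hs) as [x0 Hx0].
{ intros n. apply (Hstep n (corner n)). }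
{ intros n. destruct (Hin n). tauto. }
destruct (Hlim (fun n => snd (corner n)) t c d Ht) as [y0 Hy0].
{ intros n. apply (Hstep n (corner n)). }
{ intros n. destruct (Hin n). tauto. }
assert (Hsmall : forall eps, 0 < eps ->
  Rabs (flux P Q a b c d) <= 2 * eps * (s + t) ^ 2).
{ intros eps He.
  assert (X0 := Hx0 O). assert (Y0 := Hy0 O). cbn [corner fst snd pow] in X0, Y0.
  destruct (flux_small x0 y0 eps) as [del [Hdel Hfl]];
    [unfold s in X0; lra|unfold t in Y0; lra|exact He|].
  destruct (pow_lt_1_zero (/ 2)) with (y := del / (s + t + 1)) as [N HN].
  { rewrite Rabs_pos_eq; lra. }
  { apply Rdiv_lt_0_compat; lra. }
  specialize (HN N (le_n N)). rewrite Rabs_pos_eq in HN by (apply pow_le; lra).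
  rewrite pow_inv in HN.
  assert (L : / 2 ^ N * (s + t + 1) < del).
  { replace del with (del / (s + t + 1) * (s + t + 1)) by (field; lra).
    apply Rmult_lt_compat_r; lra. }
  assert (I2 : 0 < / 2 ^ N) by apply Rinv_0_lt_compat, P2.
  destruct (Hin N) as [I1 [I2' [I3 I4]]].
  assert (F := Hfl (fst (corner N)) (s / 2 ^ N) (snd (corner N)) (t / 2 ^ N)
    I1 (Hx0 N) I2' I3 (Hy0 N) I4).
  assert (F' := Rle_trans _ _ _ (Hbig N) (F ltac:(unfold Rdiv; nra) ltac:(unfold Rdiv; nra))).
  replace (4 ^ N) with (2 ^ N * 2 ^ N) in F'
    by (rewrite <- Rpow_mult_distr; f_equal; lra).
  assert (Hp := P2 N).
  apply (Rmult_le_compat_r (2 ^ N * 2 ^ N)) in F'; [|nra].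
  replace (Rabs (flux P Q a b c d) / (2 ^ N * 2 ^ N) * (2 ^ N * 2 ^ N))
    with (Rabs (flux P Q a b c d)) in F' by (field; lra).
  replace (2 * eps * (s / 2 ^ N + t / 2 ^ N) ^ 2 * (2 ^ N * 2 ^ N))
    with (2 * eps * (s + t) ^ 2) in F' by (field; lra).
  exact F'. }
(* The flux is at most [eps] times a constant, for every [eps]. *)
destruct (Req_dec (flux P Q a b c d) 0) as [E|N]; [exact E|exfalso].
apply Rabs_pos_lt in N.
assert (K : 0 <= (s + t) ^ 2) by apply pow2_ge_0.
assert (He : 0 < Rabs (flux P Q a b c d) / (4 * ((s + t) ^ 2 + 1)))
  by (apply Rdiv_lt_0_compat; lra).
specialize (Hsmall _ He).
set (f := Rabs (flux P Q a b c d)) in *. set (k := (s + t) ^ 2) in *.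
assert (2 * (f / (4 * (k + 1))) * k <= f / 2).
{ replace (2 * (f / (4 * (k + 1))) * k) with (f / 2 * (k / (k + 1))) by (field; lra).
  assert (k / (k + 1) <= 1).
  { apply Rmult_le_reg_r with (k + 1); [lra|].
    replace (k / (k + 1) * (k + 1)) with k by (field; lra). lra. }
  nra. }
lra.
Qed.

End Rectangle.

(** * The complex exponential and logarithms of nonvanishing functions *)

Definition cexp (z : C) : C := (exp (Re z) * cos (Im z), exp (Re z) * sin (Im z)).

Lemma cexp_plus (z w : C) : cexp (z + w) = (cexp z * cexp w)%C.
Proof.
destruct z as [a b], w as [c d]. unfold cexp, Cplus, Cmult, Re, Im; simpl.
rewrite exp_plus, cos_plus, sin_plus. f_equal; ring.
Qed.

Lemma cexp_0 : cexp 0 = 1.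
Proof. unfold cexp; simpl. rewrite exp_0, cos_0, sin_0. unfold RtoC. f_equal; ring. Qed.

Lemma Cmod_polar (r t : R) : 0 <= r -> Cmod (r * cos t, r * sin t) = r.
Proof.
intros Hr. unfold Cmod; simpl fst; simpl snd.
replace ((r * cos t) ^ 2 + (r * sin t) ^ 2) with (r ^ 2 * (Rsqr (sin t) + Rsqr (cos t)))
  by (unfold Rsqr; ring).
rewrite sin2_cos2, Rmult_1_r. apply sqrt_pow2, Hr.
Qed.

Lemma Cmod_cexp (z : C) : Cmod (cexp z) = exp (Re z).
Proof. apply Cmod_polar, Rlt_le, exp_pos. Qed.

Lemma cexp_neq_0 (z : C) : cexp z <> 0.
Proof. apply Cmod_gt_0. rewrite Cmod_cexp. apply exp_pos. Qed.

Lemma Cmod_le_sum (x y : R) : Cmod (x, y) <= Rabs x + Rabs y.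
Proof.
replace (x, y) with (RtoC x + RtoC y * Ci)%C
  by (unfold RtoC, Ci, Cplus, Cmult; simpl; f_equal; ring).
apply Rle_trans with (1 := Cmod_triangle _ _).
rewrite Cmod_mult, Cmod_Ci, !Cmod_R. lra.
Qed.

Lemma Cmod_Im_le (z : C) : Rabs (Im z) <= Cmod z.
Proof. apply Rle_trans with (2 := Rmax_Cmod z). apply Rmax_r. Qed.

Lemma derive_approx (f : R -> R) (l : R) :
  is_derive f 0 l ->
  forall eps, 0 < eps -> exists d, 0 < d /\
    forall x, Rabs x < d -> Rabs (f x - f 0 - x * l) <= eps * Rabs x.
Proof.
intros [_ H] eps He.
destruct (H 0 (fun P HP => HP) (mkposreal eps He)) as [d Hd].
exists d. split; [apply cond_pos|]. intros x Hx.
specialize (Hd x).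
unfold ball, minus, plus, opp, scal, norm in Hd; simpl in Hd.
unfold AbsRing_ball, abs, minus, plus, opp, mult in Hd; simpl in Hd.
rewrite Ropp_0, Rplus_0_r in Hd. exact (Hd Hx).
Qed.

(** The exponential has derivative [1] at [0]; its functional equation carries
    this to every point. *)
Lemma cexp_quotient_0 :
  exists q, ccont q 0 /\ q (RtoC 0) = 1 /\ forall w, (cexp w - 1 = q w * w)%C.
Proof.
destruct (linear_approx_quotient cexp 0 1) as [q [Hq [Hq0 E]]].
- intros eps He.
  (* The real and imaginary parts of the error add up to at most [6 e |w|]. *)
  set (e := Rmin 1 (eps / 8)).
  assert (e1 : e <= 1) by apply Rmin_l.
  assert (e2 : e <= eps / 8) by apply Rmin_r.
  assert (e0 : 0 < e) by (apply Rmin_pos; lra).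
  destruct (derive_approx exp 1) with (eps := e) as [d1 [D1 H1]];
    [generalize (is_derive_exp 0); rewrite exp_0; exact (fun H => H)|exact e0|].
  destruct (derive_approx cos 0) with (eps := e) as [d2 [D2 H2]];
    [generalize (is_derive_cos 0); rewrite sin_0, Ropp_0; exact (fun H => H)|exact e0|].
  destruct (derive_approx sin 1) with (eps := e) as [d3 [D3 H3]];
    [generalize (is_derive_sin 0); rewrite cos_0; exact (fun H => H)|exact e0|].
  exists (Rmin (Rmin d1 (e / 2)) (Rmin d2 d3)).
  split; [repeat apply Rmin_pos; lra|].
  intros w Hw. replace (w - 0)%C with w in * by ring.
  rewrite cexp_0.
  assert (M1 := Rmin_l (Rmin d1 (e / 2)) (Rmin d2 d3)).
  assert (M2 := Rmin_r (Rmin d1 (e / 2)) (Rmin d2 d3)).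
  assert (M3 := Rmin_l d1 (e / 2)). assert (M4 := Rmin_r d1 (e / 2)).
  assert (M5 := Rmin_l d2 d3). assert (M6 := Rmin_r d2 d3).
  destruct w as [x y].
  assert (Wx := re_le_Cmod (x, y)). assert (Wy := Cmod_Im_le (x, y)).
  change (Re (x, y)) with x in Wx. change (Im (x, y)) with y in Wy.
  set (m := Cmod (x, y)) in *.
  assert (A1 := H1 x ltac:(lra)). assert (A2 := H2 y ltac:(lra)).
  assert (A3 := H3 y ltac:(lra)).
  rewrite exp_0 in A1. rewrite cos_0 in A2. rewrite sin_0 in A3.
  assert (Px := Rabs_pos x). assert (Py := Rabs_pos y).
  assert (Ex : Rabs (exp x - 1) <= e).
  { replace (exp x - 1) with ((exp x - 1 - x * 1) + x) by ring.
    apply Rle_trans with (1 := Rabs_triang _ _). nra. }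
  assert (Ex2 : Rabs (exp x) <= 2).
  { replace (exp x) with ((exp x - 1) + 1) by ring.
    apply Rle_trans with (1 := Rabs_triang _ _). rewrite Rabs_R1. lra. }
  replace (cexp (x, y) - 1 - (x, y) * 1)%C
    with ((exp x - 1 - x * 1) + exp x * (cos y - 1 - y * 0),
          exp x * (sin y - 0 - y * 1) + (exp x - 1) * y)
    by (unfold cexp, RtoC, Cminus, Cplus, Copp, Cmult; simpl; f_equal; ring).
  apply Rle_trans with (1 := Cmod_le_sum _ _).
  assert (B1 := Rabs_triang (exp x - 1 - x * 1) (exp x * (cos y - 1 - y * 0))).
  assert (B2 := Rabs_triang (exp x * (sin y - 0 - y * 1)) ((exp x - 1) * y)).
  rewrite Rabs_mult in B1. rewrite !Rabs_mult in B2.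
  assert (Pe := Rabs_pos (exp x)).
  assert (C1 : Rabs (exp x) * Rabs (cos y - 1 - y * 0) <= 2 * (e * Rabs y))
    by (apply Rmult_le_compat; auto using Rabs_pos).
  assert (C2 : Rabs (exp x) * Rabs (sin y - 0 - y * 1) <= 2 * (e * Rabs y))
    by (apply Rmult_le_compat; auto using Rabs_pos).
  assert (C3 : Rabs (exp x - 1) * Rabs y <= e * Rabs y)
    by (apply Rmult_le_compat_r; auto).
  assert (C4 : e * Rabs x <= e * m) by (apply Rmult_le_compat_l; lra).
  assert (C5 : e * Rabs y <= e * m) by (apply Rmult_le_compat_l; lra).
  assert (C6 : e * m <= eps / 8 * m) by (apply Rmult_le_compat_r; lra).
  assert (0 <= eps * m) by (apply Rmult_le_pos; lra).
  lra.
- exists q. split; [exact Hq|]. split; [exact Hq0|].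
  intros w. specialize (E w). rewrite cexp_0 in E. rewrite E. ring.
Qed.

Lemma cdiff_cexp (z : C) : cdiff cexp z.
Proof.
destruct cexp_quotient_0 as [q [Hq [_ E]]].
exists (fun w => q (w - z) * cexp z)%C. split.
- apply ccont_mult; [|apply ccont_const].
  apply (ccont_comp (fun w => w - z)%C).
  + apply ccont_minus; [apply ccont_id|apply ccont_const].
  + replace (z - z)%C with (RtoC 0) by ring. exact Hq.
- intros w. replace (cexp w) with (cexp (w - z) * cexp z)%C
    by (rewrite <- cexp_plus; f_equal; ring).
  replace (cexp (w - z) * cexp z - cexp z)%C
    with ((cexp (w - z) - 1) * cexp z)%C by ring.
  rewrite E. ring.
Qed.

(** Near [z] the increment of [F] is the increment of [L] times a factor that
    does not vanish, because [(cexp u - 1) / u] tends to [1] as [u] tends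
    to [0]. *)
Lemma cdiff_log (F L : C -> C) (z c : C) (d : R) :
  0 < d -> c <> 0 ->
  (forall w, Cmod (w - z) < d -> cexp (L w) = (F w / c)%C) ->
  ccont L z -> cdiff F z -> cdiff L z.
Proof.
intros Hd Hc HL CL [p [Hp Ep]].
destruct cexp_quotient_0 as [q [Hq [Hq0 Eq]]].
assert (Cq : ccont (fun w => q (L w - L z)%C) z).
{ apply (ccont_comp (fun w => L w - L z)%C).
  - apply ccont_minus; [exact CL|apply ccont_const].
  - replace (L z - L z)%C with (RtoC 0) by ring. exact Hq. }
assert (Nz : q (L z - L z)%C <> 0).
{ replace (L z - L z)%C with (RtoC 0) by ring. rewrite Hq0.
  intro E. injection E. lra. }
destruct (ccont_neq _ _ _ Cq Nz) as [d' [Hd' Hn]].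
apply (cdiff_local L (fun w => p w / (q (L w - L z) * cexp (L z) * c))%C z (Rmin d d')).
- apply Rmin_pos; assumption.
- apply ccont_div; [exact Hp| |].
  + apply (ccont_mult _ (fun _ => c)); [|apply ccont_const].
    apply (ccont_mult _ (fun _ => cexp (L z))); [exact Cq|apply ccont_const].
  + repeat apply Cmult_neq_0; try assumption. apply cexp_neq_0.
- intros w Hw.
  assert (Hw1 := Rlt_le_trans _ _ _ Hw (Rmin_l _ _)).
  assert (Hw2 := Rlt_le_trans _ _ _ Hw (Rmin_r _ _)).
  assert (Hz : Cmod (z - z) < d)
    by (replace (z - z)%C with (RtoC 0) by ring; rewrite Cmod_0; exact Hd).
  assert (K : (p w * (w - z) = (L w - L z) * (q (L w - L z) * cexp (L z) * c))%C).
  { rewrite <- Ep.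
    replace (F w) with (cexp (L w) * c)%C by (rewrite (HL w Hw1); field; exact Hc).
    replace (F z) with (cexp (L z) * c)%C by (rewrite (HL z Hz); field; exact Hc).
    replace (cexp (L w)) with (cexp (L w - L z) * cexp (L z))%C
      by (rewrite <- cexp_plus; f_equal; ring).
    replace (cexp (L w - L z)) with (1 + q (L w - L z) * (L w - L z))%C
      by (rewrite <- Eq; ring).
    ring. }
  assert (Dn : (q (L w - L z) * cexp (L z) * c)%C <> 0).
  { repeat apply Cmult_neq_0; try assumption; [apply Hn, Hw2|apply cexp_neq_0]. }
  replace (p w / (q (L w - L z) * cexp (L z) * c) * (w - z))%C
    with (p w * (w - z) / (q (L w - L z) * cexp (L z) * c))%C by (unfold Cdiv; ring).
  rewrite K. unfold Cdiv. rewrite <- Cmult_assoc, Cinv_r by exact Dn. ring.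
Qed.

(** The principal logarithm on the right half-plane. *)
Definition clog (w : C) : C := (ln (Cmod w), atan (Im w / Re w)).

Lemma cexp_clog (w : C) : 0 < Re w -> cexp (clog w) = w.
Proof.
destruct w as [x y]. intros Hx. unfold cexp, clog, Re, Im in *; simpl in *.
assert (Ht : 0 < sqrt (1 + Rsqr (y / x)))
  by (apply sqrt_lt_R0; assert (A := Rle_0_sqr (y / x)); lra).
assert (Hm : Cmod (x, y) = x * sqrt (1 + Rsqr (y / x))).
{ unfold Cmod; simpl fst; simpl snd.
  rewrite <- (sqrt_pow2 x) at 2 by lra. rewrite <- sqrt_mult_alt by apply pow2_ge_0.
  f_equal. unfold Rsqr. field. lra. }
rewrite exp_ln by (rewrite Hm; apply Rmult_lt_0_compat; assumption).
rewrite cos_atan, sin_atan, Hm. f_equal; field; lra.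
Qed.

Lemma ccont_clog (w : C) : 0 < Re w -> ccont clog w.
Proof.
intros Hw. apply (continuous_pair C_UniformSpace).
- apply (continuous_comp Cmod ln); [apply continuous_Cmod|].
  apply continuous_ln. apply Rlt_le_trans with (1 := Hw).
  apply Rle_trans with (2 := re_le_Cmod w). apply Rle_abs.
- apply (continuous_comp (fun w : C_UniformSpace => Im w / Re w) atan).
  + apply (@continuous_mult C_UniformSpace R_AbsRing); [apply continuous_Im|].
    apply (continuous_comp Re Rinv); [apply continuous_Re|].
    apply continuous_Rinv. lra.
  + apply continuous_atan.
Qed.

Lemma clog_1 : clog 1 = 0.
Proof.
unfold clog. rewrite Cmod_1, ln_1. simpl. unfold Rdiv. rewrite Rmult_0_l, atan_0.
reflexivity.
Qed.

Lemma quotient_Re_pos (a b c : C) :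
  c <> 0 -> Cmod (a - c) < Cmod c / 4 -> Cmod (b - c) < Cmod c / 4 ->
  0 < Re (b / a)%C.
Proof.
intros Hc Ha Hb.
assert (Pc : 0 < Cmod c) by (apply Cmod_gt_0, Hc).
assert (A1 : 3 * Cmod c / 4 < Cmod a).
{ assert (T := Cmod_triangle a (- (a - c))). rewrite Cmod_opp in T.
  replace (a + - (a - c))%C with c in T by ring. lra. }
assert (A2 : Cmod (b - a) < Cmod c / 2).
{ assert (T := Cmod_triangle (b - c) (- (a - c))). rewrite Cmod_opp in T.
  replace (b - c + - (a - c))%C with (b - a)%C in T by ring. lra. }
assert (Na : a <> 0) by (apply Cmod_gt_0; lra).
assert (A3 : Cmod ((b - a) / a) < 1).
{ rewrite Cmod_div by exact Na. apply Rmult_lt_reg_r with (Cmod a); [lra|].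
  unfold Rdiv. rewrite Rmult_assoc, Rinv_l by lra. lra. }
replace (b / a)%C with (1 + (b - a) / a)%C by (field; exact Na).
assert (T := re_le_Cmod ((b - a) / a)). apply Rabs_le_between in T.
change (0 < 1 + Re ((b - a) / a)%C). lra.
Qed.

(** Compactness of the disk of radius [r] makes the gauge of the local estimate
    [quotient_Re_pos] uniform. *)
Lemma uniform_quotient_Re_pos (F : C -> C) (r R : R) :
  r < R ->
  (forall z, Cmod z < R -> ccont F z) -> (forall z, Cmod z < R -> F z <> 0) ->
  exists d, 0 < d /\ forall p q, Cmod p <= r -> Cmod q <= r -> Cmod (q - p) < d ->
    0 < Re (F q / F p)%C.
Proof.
intros Hr HC HN.
assert (Loc : forall u v, exists e : posreal, forall p q,
  Cmod p <= r -> Cmod q <= r -> Cmod (p - (u, v)) < 2 * e -> Cmod (q - p) < e ->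
  0 < Re (F q / F p)%C).
{ intros u v. destruct (Rle_lt_dec (Cmod (u, v)) r) as [Hin|Hout].
  - assert (Hin' : Cmod (u, v) < R) by lra.
    assert (Pm : 0 < Cmod (F (u, v)) / 4).
    { assert (A := proj1 (Cmod_gt_0 _) (HN _ Hin')). lra. }
    destruct (proj1 (ccont_Cmod F (u, v)) (HC _ Hin') _ Pm) as [d [Hd H]].
    assert (Hd3 : 0 < d / 3) by lra.
    exists (mkposreal _ Hd3). simpl. intros p q Hp Hq H1 H2.
    apply quotient_Re_pos with (F (u, v)).
    + apply HN, Hin'.
    + apply H. lra.
    + apply H. replace (q - (u, v))%C with ((q - p) + (p - (u, v)))%C by ring.
      apply Rle_lt_trans with (1 := Cmod_triangle _ _). lra.
  (* Compactness is applied to a square; a centre outside the disk gets a gauge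
     too small to reach the disk. *)
  - assert (He : 0 < (Cmod (u, v) - r) / 2) by lra.
    exists (mkposreal _ He). simpl. intros p q Hp Hq H1 H2. exfalso.
    assert (T := Cmod_triangle p (- (p - (u, v)))). rewrite Cmod_opp in T.
    set (c := (u, v) : C) in *. replace (p + - (p - c))%C with c in T by ring. lra. }
set (del := fun u v => proj1_sig (constructive_indefinite_description _ (Loc u v))).
destruct (compactness_value_2d (- r) r (- r) r del) as [d Hd].
exists d. split; [apply cond_pos|]. intros p q Hp Hq Hpq.
assert (X := re_le_Cmod p). assert (Y := Cmod_Im_le p).
destruct p as [x y]. change (Re (x, y)) with x in X. change (Im (x, y)) with y in Y.
assert (X1 : - r <= x <= r) by (apply Rabs_le_between; lra).
assert (Y1 : - r <= y <= r) by (apply Rabs_le_between; lra).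
destruct (NNPP _ (Hd x y X1 Y1)) as [u [v [_ [_ [U [V D]]]]]].
unfold del in U, V, D.
destruct (constructive_indefinite_description _ (Loc u v)) as [e He]; simpl in U, V, D.
apply He; try assumption.
- replace ((x, y) - (u, v))%C with (x - u, y - v) by reflexivity.
  apply Rle_lt_trans with (1 := Cmod_le_sum _ _). lra.
- lra.
Qed.

(** The logarithm is the sum of the principal logarithms of the quotients of [F]
    at consecutive points of a fine subdivision of the segment from [0] to
    [z]. *)
Lemma exists_log (F : C -> C) (r R : R) :
  0 < r < R ->
  (forall z, Cmod z < R -> ccont F z) -> (forall z, Cmod z < R -> F z <> 0) ->
  exists L : C -> C, L (RtoC 0) = RtoC 0 /\
    forall z, Cmod z < r ->
      ccont L z /\ cexp (L z) = (F z / F (RtoC 0))%C /\ (cdiff F z -> cdiff L z).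
Proof.
intros Hr HC HN.
destruct (uniform_quotient_Re_pos F r R (proj2 Hr) HC HN) as [d [Hd HQ]].
destruct (nfloor_ex (r / d)) as [n0 [_ Hn0]].
{ apply Rlt_le, Rdiv_lt_0_compat; lra. }
set (n := INR (S n0)).
assert (Pn : 0 < n) by (apply lt_0_INR; lia).
assert (Hn : r / n < d).
{ unfold n. rewrite S_INR. assert (P0 := pos_INR n0). apply Rmult_lt_reg_r with (INR n0 + 1); [lra|].
  unfold Rdiv in *. rewrite Rmult_assoc, Rinv_l, Rmult_1_r by lra.
  apply Rmult_lt_reg_r with (/ d); [apply Rinv_0_lt_compat, Hd|].
  replace (d * (INR n0 + 1) * / d) with (INR n0 + 1) by (field; lra). exact Hn0. }
set (pt := fun (k : nat) (z : C) => (RtoC (INR k / n) * z)%C).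
set (L := fix L (k : nat) (z : C) : C :=
  match k with
  | O => RtoC 0
  | S m => (L m z + clog (F (pt (S m) z) / F (pt m z)))%C
  end).
assert (Fr : forall k, (k <= S n0)%nat -> 0 <= INR k / n <= 1).
{ intros k Hk. split.
  - apply Rmult_le_pos; [apply pos_INR|apply Rlt_le, Rinv_0_lt_compat, Pn].
  - apply Rmult_le_reg_r with n; [exact Pn|].
    unfold Rdiv. rewrite Rmult_assoc, Rinv_l by lra.
    apply le_INR in Hk. fold n in Hk. lra. }
assert (Hpt : forall k z, (k <= S n0)%nat -> Cmod z < r -> Cmod (pt k z) <= Cmod z).
{ intros k z Hk Hz. unfold pt. rewrite Cmod_mult, Cmod_R.
  assert (A := Fr k Hk). rewrite Rabs_pos_eq by lra. assert (B := Cmod_ge_0 z). nra. }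
assert (Hpos : forall k z, (S k <= S n0)%nat -> Cmod z < r ->
  0 < Re (F (pt (S k) z) / F (pt k z))%C).
{ intros k z Hk Hz. apply HQ.
  - assert (A := Hpt k z ltac:(lia) Hz). lra.
  - assert (A := Hpt (S k) z Hk Hz). lra.
  - replace (pt (S k) z - pt k z)%C with (RtoC (/ n) * z)%C.
    + rewrite Cmod_mult, Cmod_R, Rabs_pos_eq by (apply Rlt_le, Rinv_0_lt_compat, Pn).
      apply Rle_lt_trans with (2 := Hn). unfold Rdiv. rewrite Rmult_comm.
      apply Rmult_le_compat_r; [apply Rlt_le, Rinv_0_lt_compat, Pn|lra].
    + unfold pt. rewrite S_INR. replace ((INR k + 1) / n) with (INR k / n + / n) by (field; lra).
      rewrite RtoC_plus. ring. }
assert (HL : forall k z, (k <= S n0)%nat -> Cmod z < r ->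
  ccont (L k) z /\ cexp (L k z) = (F (pt k z) / F (RtoC 0))%C).
{ assert (N0 : F (RtoC 0) <> 0) by (apply HN; rewrite Cmod_0; lra).
  intros k z Hk Hz. induction k as [|k IH].
  - split; [apply ccont_const|]. cbn [L]. rewrite cexp_0. unfold pt.
    replace (RtoC (INR 0 / n) * z)%C with (RtoC 0); [field; exact N0|].
    simpl INR. unfold Rdiv. rewrite Rmult_0_l. ring.
  - destruct IH as [IH1 IH2]; [lia|].
    assert (Cp : forall j, (j <= S n0)%nat -> ccont (fun w => F (pt j w)) z).
    { intros j Hj. apply (ccont_comp (pt j)).
      - apply ccont_mult; [apply ccont_const|apply ccont_id].
      - apply HC. assert (A := Hpt j z Hj Hz). lra. }
    assert (Np : F (pt k z) <> 0).
    { apply HN. assert (A := Hpt k z ltac:(lia) Hz). lra. }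
    split.
    + apply (ccont_plus (L k)); [exact IH1|].
      apply (ccont_comp (fun w => F (pt (S k) w) / F (pt k w))%C).
      * apply ccont_div; [apply Cp, Hk|apply Cp; lia|exact Np].
      * apply ccont_clog, Hpos; assumption.
    + cbn [L]. rewrite cexp_plus, IH2, cexp_clog by (apply Hpos; assumption).
      field. split; assumption. }
assert (Hend : forall z, pt (S n0) z = z).
{ intros z. unfold pt. fold n. replace (n / n) with 1 by (field; lra). ring. }
exists (L (S n0)). split.
- assert (Z : forall k, pt k (RtoC 0) = RtoC 0) by (intro; unfold pt; ring).
  assert (N0 : F (RtoC 0) <> 0) by (apply HN; rewrite Cmod_0; lra).
  generalize (S n0). intros k. induction k as [|k IH]; [reflexivity|].
  cbn [L]. rewrite IH, !Z. unfold Cdiv. rewrite Cinv_r by exact N0. rewrite clog_1. ring.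
- assert (HE : forall z, Cmod z < r ->
    ccont (L (S n0)) z /\ cexp (L (S n0) z) = (F z / F (RtoC 0))%C).
  { intros z Hz. rewrite <- (Hend z) at 3. apply HL; [lia|exact Hz]. }
  intros z Hz. split; [apply HE, Hz|]. split; [apply HE, Hz|].
  intros HD. apply (cdiff_log F _ z (F (RtoC 0)) (r - Cmod z)).
  + lra.
  + apply HN. rewrite Cmod_0. lra.
  + intros w Hw. apply HE.
    replace w with ((w - z) + z)%C by ring.
    apply Rle_lt_trans with (1 := Cmod_triangle _ _). lra.
  + apply HE, Hz.
  + exact HD.
Qed.

(** * Circular means *)

Definition circle (r t : R) : C := (r * cos t, r * sin t).

Lemma Cmod_circle (r t : R) : 0 <= r -> Cmod (circle r t) = r.
Proof. apply Cmod_polar. Qed.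

Lemma continuous_circle (r t : R) : @continuous R_UniformSpace C_UniformSpace (circle r) t.
Proof.
apply (continuous_pair R_UniformSpace (fun t => r * cos t) (fun t => r * sin t));
apply (@continuous_mult R_UniformSpace R_AbsRing); try apply continuous_const.
- apply continuous_cos.
- apply continuous_sin.
Qed.

Lemma cexp_ln (r t : R) : 0 < r -> cexp (ln r, t) = circle r t.
Proof. intros Hr. unfold cexp, circle; simpl. rewrite exp_ln by exact Hr. reflexivity. Qed.

(** The Cauchy-Riemann equations say that [(Re K, - Im K)] has no divergence. *)
Lemma cdiff_solenoidal (K : C -> C) (x y : R) :
  cdiff K (x, y) ->
  solenoidal_at (fun x y => Re (K (x, y))) (fun x y => - Im (K (x, y))) x y.
Proof.
intros [q [Hq E]].
exists (Re (q (x, y))), (- Im (q (x, y))), (- Im (q (x, y))).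
intros eps He. destruct (proj1 (ccont_Cmod q (x, y)) Hq eps He) as [d [Hd H]].
exists (d / 2). split; [lra|]. intros u v Hu Hv.
assert (B : Cmod ((u, v) - (x, y))%C <= Rabs (u - x) + Rabs (v - y))
  by exact (Cmod_le_sum (u - x) (v - y)).
specialize (H (u, v) ltac:(lra)). specialize (E (u, v)).
assert (M : Cmod ((q (u, v) - q (x, y)) * ((u, v) - (x, y)))%C
  <= eps * (Rabs (u - x) + Rabs (v - y))).
{ rewrite Cmod_mult. apply Rmult_le_compat; auto using Cmod_ge_0; lra. }
replace ((q (u, v) - q (x, y)) * ((u, v) - (x, y)))%C
  with (K (u, v) - K (x, y) - q (x, y) * ((u, v) - (x, y)))%C in M
  by (rewrite E; ring).
assert (M1 := re_le_Cmod (K (u, v) - K (x, y) - q (x, y) * ((u, v) - (x, y)))).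
assert (M2 := Cmod_Im_le (K (u, v) - K (x, y) - q (x, y) * ((u, v) - (x, y)))).
destruct (K (u, v)) as [k1 k2], (K (x, y)) as [l1 l2], (q (x, y)) as [q1 q2].
unfold Re, Im, Cminus, Cplus, Copp, Cmult in *; simpl in *.
split.
- match goal with |- Rabs ?g <= _ => match type of M1 with Rabs ?h <= _ =>
    replace g with h by ring end end. lra.
- match goal with |- Rabs ?g <= _ => match type of M2 with Rabs ?h <= _ =>
    replace g with (- h) by ring end end. rewrite Rabs_Ropp. lra.
Qed.

(** In the coordinates [z = exp (x + i y)] circles become vertical segments, and
    the horizontal sides of a rectangle of height [2 PI] cancel by periodicity;
    so the mean over the circles does not depend on the radius, and the radius
    can shrink to [0]. *)
Lemma mean_Re_eq_0 (L : C -> C) (r R : R) :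
  0 < r < R ->
  (forall z, Cmod z < R -> ccont L z) ->
  (forall z, Cmod z < R -> z <> 0 -> cdiff L z) ->
  L (RtoC 0) = RtoC 0 ->
  RInt (fun t => Re (L (circle r t))) 0 (2 * PI) = 0.
Proof.
intros Hr HC HD H0. assert (Ppi := PI_RGT_0).
set (P := fun x y => Re (L (cexp (x, y)))).
set (Q := fun x y => - Im (L (cexp (x, y)))).
assert (Hin : forall x y, x <= ln r -> Cmod (cexp (x, y)) <= r).
{ intros x y Hx. rewrite Cmod_cexp. rewrite <- (exp_ln r) by lra.
  destruct Hx as [Hx| ->]; [|right; reflexivity]. left. apply exp_increasing, Hx. }
assert (Hsol : forall x y, x <= ln r -> solenoidal_at P Q x y).
{ intros x y Hx. apply (cdiff_solenoidal (fun z => L (cexp z))).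
  apply cdiff_comp; [apply cdiff_cexp|].
  apply HD; [|apply cexp_neq_0]. assert (A := Hin x y Hx). lra. }
assert (Ex : forall x, x <= ln r -> ex_RInt (P x) 0 (2 * PI)).
{ intros x Hx. apply ex_RInt_cont; [lra|]. intros y _.
  apply (solenoidal_continuous P Q x y), Hsol, Hx. }
assert (Eq : forall x, x <= ln r -> RInt (P (ln r)) 0 (2 * PI) = RInt (P x) 0 (2 * PI)).
{ intros x Hx.
  assert (F : flux P Q x (ln r) 0 (2 * PI) = 0).
  { apply flux_eq_0; [|exact Hx|lra]. intros u v Hu _. apply Hsol. lra. }
  unfold flux in F.
  rewrite (RInt_ext (fun x => Q x (2 * PI)) (fun x => Q x 0)) in F; [lra|].
  intros u _. unfold Q, cexp. simpl. rewrite cos_2PI, sin_2PI, cos_0, sin_0. reflexivity. }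
transitivity (RInt (P (ln r)) 0 (2 * PI)).
{ apply RInt_ext. intros t _. unfold P. rewrite cexp_ln by lra. reflexivity. }
(* A nonzero mean [m] would persist on circles on which [|L|] is small. *)
destruct (Req_dec (RInt (P (ln r)) 0 (2 * PI)) 0) as [E|N]; [exact E|exfalso].
apply Rabs_pos_lt in N. set (m := Rabs (RInt (P (ln r)) 0 (2 * PI))) in *.
assert (He : 0 < m / (4 * PI)) by (apply Rdiv_lt_0_compat; lra).
destruct (proj1 (ccont_Cmod L 0) (HC 0%C ltac:(rewrite Cmod_0; lra)) _ He) as [d [Hd H]].
set (x := Rmin (ln r) (ln (d / 2))).
assert (Hx : x <= ln r) by apply Rmin_l.
assert (Hx2 : exp x <= d / 2).
{ rewrite <- (exp_ln (d / 2)) by lra.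
  destruct (Rmin_r (ln r) (ln (d / 2))) as [A|A]; fold x in A.
  - left. apply exp_increasing, A.
  - rewrite A. right; reflexivity. }
assert (B : Rabs (RInt (P x) 0 (2 * PI)) <= (2 * PI - 0) * (m / (4 * PI))).
{ apply abs_RInt_le_const; [lra|apply Ex, Hx|]. intros t _.
  apply Rle_trans with (1 := re_le_Cmod _). left.
  replace (L (cexp (x, t))) with (L (cexp (x, t)) - L (RtoC 0))%C by (rewrite H0; ring).
  apply H. replace (cexp (x, t) - 0)%C with (cexp (x, t)) by ring.
  rewrite Cmod_cexp. change (exp x < d). lra. }
rewrite <- (Eq x Hx) in B. fold m in B.
replace ((2 * PI - 0) * (m / (4 * PI))) with (m / 2) in B by (field; lra). lra.
Qed.

Definition ln_mod (F : C -> C) (z : C) : R := ln (Cmod (F z)).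

Lemma ex_RInt_circle (f : C -> R) (r : R) :
  0 < r -> (forall z, Cmod z = r -> @continuous C_UniformSpace R_UniformSpace f z) ->
  ex_RInt (fun t => f (circle r t)) 0 (2 * PI).
Proof.
intros Hr H. apply ex_RInt_cont; [assert (A := PI_RGT_0); lra|]. intros t _.
apply (continuous_comp (circle r) f); [apply continuous_circle|].
apply H, Cmod_circle. lra.
Qed.

Lemma continuous_ln_mod (F : C -> C) (z : C) :
  ccont F z -> F z <> 0 -> @continuous C_UniformSpace R_UniformSpace (ln_mod F) z.
Proof.
intros HC HN. apply (continuous_comp (fun w => Cmod (F w)) ln).
- apply (continuous_comp F Cmod); [exact HC|apply continuous_Cmod].
- apply continuous_ln, Cmod_gt_0, HN.
Qed.

(** [ln |F / F 0|] is the real part of a logarithm that vanishes at [0]. *)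
Lemma mean_ln_mod (F : C -> C) (r R : R) :
  0 < r < R ->
  (forall z, Cmod z < R -> ccont F z) ->
  (forall z, Cmod z < R -> z <> 0 -> cdiff F z) ->
  (forall z, Cmod z < R -> F z <> 0) ->
  RInt (fun t => ln_mod F (circle r t)) 0 (2 * PI) = 2 * PI * ln_mod F 0.
Proof.
intros Hr HC HD HN.
assert (N0 : F (RtoC 0) <> 0) by (apply HN; rewrite Cmod_0; lra).
set (rho := (r + R) / 2).
destruct (exists_log F rho R) as [L [L0 HL]]; [unfold rho; lra|exact HC|exact HN|].
assert (M := mean_Re_eq_0 L r rho ltac:(unfold rho; lra) (fun z Hz => proj1 (HL z Hz))).
specialize (fun H => M H L0).
transitivity (RInt (fun t => Re (L (circle r t)) + ln_mod F 0) 0 (2 * PI)).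
- apply RInt_ext. intros t _.
  assert (Hz : Cmod (circle r t) < rho) by (rewrite Cmod_circle; unfold rho; lra).
  assert (HzR : Cmod (circle r t) < R) by (unfold rho in Hz; lra).
  destruct (HL _ Hz) as [_ [E _]]. apply (f_equal Cmod) in E.
  rewrite Cmod_cexp, Cmod_div in E by exact N0.
  assert (P1 := proj1 (Cmod_gt_0 _) (HN _ HzR)).
  assert (P2 := proj1 (Cmod_gt_0 _) N0).
  apply (f_equal ln) in E. rewrite ln_exp, ln_div in E by assumption.
  assert (E' : ln_mod F (circle r t) = Re (L (circle r t)) + ln_mod F 0)
    by (unfold ln_mod; lra).
  exact E'.
- assert (Ex : ex_RInt (fun t => Re (L (circle r t))) 0 (2 * PI)).
  { apply (ex_RInt_circle (fun z => Re (L z))); [lra|]. intros z Hz.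
    apply (continuous_comp L Re); [|apply continuous_Re].
    apply HL. unfold rho. lra. }
  rewrite (RInt_plus (fun t => Re (L (circle r t))) (fun _ => ln_mod F 0));
    [|exact Ex|apply ex_RInt_const].
  rewrite M.
  + rewrite (RInt_const 0 (2 * PI) (ln_mod F 0)).
    unfold plus, scal; simpl. unfold mult; simpl. ring.
  + intros z Hz Nz. apply HL; [exact Hz|].
    apply HD; [unfold rho in Hz; lra|exact Nz].
Qed.

(** * The Landen transformation *)

(** The function [f z = z ^ N * k z] on the disk of radius [R], carried by its
    nonvanishing factor [k]; differentiability is asked only away from [0]. *)
Definition omits_1 (R : R) (N : nat) (k : C -> C) : Prop :=
  (1 <= N)%nat /\
  (forall z, Cmod z < R -> ccont k z) /\
  (forall z, Cmod z < R -> z <> 0 -> cdiff k z) /\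
  (forall z, Cmod z < R -> k z <> 0) /\
  (forall z, Cmod z < R -> (z ^ N * k z)%C <> 1).

Lemma cdiff_pow (N : nat) (z : C) : cdiff (fun w => w ^ N)%C z.
Proof.
induction N as [|N IH]; [apply (cdiff_const 1)|].
apply (cdiff_mult (fun w => w) (fun w => (w ^ N)%C)); [apply cdiff_id|exact IH].
Qed.

(** [2 * PI] times the circular mean of [ln (1 + |f|)]; this is a smooth
    substitute for the Nevanlinna characteristic, for which the Landen
    transformation loses no constant. *)
Definition growth (r : R) (N : nat) (k : C -> C) : R :=
  RInt (fun t => ln (1 + Cmod (circle r t ^ N * k (circle r t))%C)) 0 (2 * PI).

Lemma continuous_ln_1_Cmod (F : C -> C) (z : C) :
  ccont F z -> @continuous C_UniformSpace R_UniformSpace (fun w => ln (1 + Cmod (F w))) z.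
Proof.
intros HC. apply (continuous_comp (fun w => 1 + Cmod (F w)) ln).
- apply (@continuous_plus C_UniformSpace R_AbsRing R_NormedModule);
    [apply continuous_const|].
  apply (continuous_comp F Cmod); [exact HC|apply continuous_Cmod].
- apply continuous_ln. assert (A := Cmod_ge_0 (F z)). lra.
Qed.

Lemma ex_RInt_growth (r R : R) (N : nat) (k : C -> C) :
  0 < r < R -> omits_1 R N k ->
  ex_RInt (fun t => ln (1 + Cmod (circle r t ^ N * k (circle r t))%C)) 0 (2 * PI).
Proof.
intros Hr [_ [HC _]].
apply (ex_RInt_circle (fun z => ln (1 + Cmod (z ^ N * k z)%C))); [lra|]. intros z Hz.
apply (continuous_ln_1_Cmod (fun z => z ^ N * k z)%C).
apply ccont_mult; [apply cdiff_ccont, cdiff_pow|apply HC; lra].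
Qed.

(** [ln |k|] has mean [ln |k(0)|], and [ln |f| <= ln (1 + |f|)]. *)
Lemma growth_bound (r R : R) (N : nat) (k : C -> C) :
  0 < r < R -> omits_1 R N k ->
  2 * PI * (ln_mod k 0 + INR N * ln r) <= growth r N k.
Proof.
intros Hr HO. assert (Ppi := PI_RGT_0).
assert (Ex := ex_RInt_growth r R N k Hr HO).
destruct HO as [_ [HC [HD [HN _]]]].
assert (Ek : ex_RInt (fun t => ln_mod k (circle r t)) 0 (2 * PI)).
{ apply ex_RInt_circle; [lra|]. intros z Hz.
  apply continuous_ln_mod; [apply HC|apply HN]; lra. }
rewrite Rmult_plus_distr_l, <- (mean_ln_mod k r R Hr HC HD HN).
replace (2 * PI * (INR N * ln r)) with (RInt (fun _ => INR N * ln r) 0 (2 * PI))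
  by (rewrite RInt_const; unfold scal; simpl; unfold mult; simpl; ring).
rewrite <- (RInt_plus (fun t => ln_mod k (circle r t)) (fun _ => INR N * ln r));
  [|exact Ek|apply ex_RInt_const].
apply RInt_le; [lra| |exact Ex|].
- apply (ex_RInt_plus (fun t => ln_mod k (circle r t)) (fun _ => INR N * ln r));
    [exact Ek|apply ex_RInt_const].
- intros t _. unfold plus; simpl. unfold ln_mod.
  assert (Pk : 0 < Cmod (k (circle r t)))
    by (apply Cmod_gt_0, HN; rewrite Cmod_circle; lra).
  assert (Pr : 0 < r ^ N) by (apply pow_lt; lra).
  rewrite <- ln_pow by lra. rewrite Cmod_mult, Cmod_pow, Cmod_circle by lra.
  rewrite <- ln_mult by assumption.
  left. apply ln_increasing; nra.
Qed.

(** With [g ^ 2 = 1 - f] and [h = (1 - g) / (1 + g)], the parallelogram law gives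
    [1 + |h ^ 2| = 2 (1 + |g| ^ 2) / |1 + g| ^ 2 <= 4 (1 + |f|) / |1 + g| ^ 2]. *)
Lemma landen_pointwise (f g : C) :
  (g * g = 1 - f)%C -> (1 + g)%C <> 0 ->
  ln (1 + Cmod ((f / ((1 + g) * (1 + g))) * (f / ((1 + g) * (1 + g))))%C)
    + 2 * ln (Cmod (1 + g)) <= ln (1 + Cmod f) + 2 * ln 2.
Proof.
intros E N.
replace (f / ((1 + g) * (1 + g)))%C with ((1 - g) / (1 + g))%C.
2:{ replace f with (1 - g * g)%C by (rewrite E; ring). field. exact N. }
rewrite Cmod_mult, Cmod_div by exact N.
assert (Pp : 0 < Cmod (1 + g)) by (apply Cmod_gt_0, N).
set (p := Cmod (1 + g)) in *. set (m := Cmod (1 - g)).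
assert (Par : p ^ 2 + m ^ 2 = 2 + 2 * Cmod g ^ 2).
{ unfold p, m. rewrite !Cmod2_alt. destruct g as [x y].
  unfold Re, Im, Cminus, Cplus, Copp, RtoC; simpl. ring. }
assert (Bg : Cmod g ^ 2 <= 1 + Cmod f).
{ rewrite <- Cmod_pow. replace (g ^ 2)%C with (1 + - f)%C by (simpl; rewrite Cmult_1_r, E; ring).
  apply Rle_trans with (1 := Cmod_triangle _ _). rewrite Cmod_opp, Cmod_1. lra. }
assert (Pf := Cmod_ge_0 f). assert (Pm := Cmod_ge_0 (1 - g)). fold m in Pm.
assert (Ph : 0 <= m / p * (m / p)) by (apply Rle_0_sqr).
replace (2 * ln p) with (ln (p * p)) by (rewrite ln_mult by lra; ring).
replace (2 * ln 2) with (ln (2 * 2)) by (rewrite ln_mult by lra; ring).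
rewrite <- !ln_mult by nra.
apply ln_le; [nra|].
replace ((1 + m / p * (m / p)) * (p * p)) with (p ^ 2 + m ^ 2) by (field; lra).
lra.
Qed.

(** The new function is [h ^ 2] with [h = (1 - g) / (1 + g) = f / (1 + g) ^ 2],
    where [g ^ 2 = 1 - f] and [g 0 = 1]; so its nonvanishing factor is
    [(k / (1 + g) ^ 2) ^ 2].  It omits [1] because [h ^ 2 = 1] forces [g = 0].
    The disk shrinks because logarithms are only found on smaller disks. *)
Lemma landen_step (r R : R) (N : nat) (k : C -> C) :
  0 < r < R -> omits_1 R N k ->
  exists rho k', r < rho /\ omits_1 rho (2 * N) k' /\
    ln_mod k' 0 = 2 * ln_mod k 0 - ln 16 /\
    growth r (2 * N) k' <= growth r N k.
Proof.
intros Hr HO. assert (Ppi := PI_RGT_0).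
assert (ExN := ex_RInt_growth r R N k Hr HO).
destruct HO as [HN1 [HC [HD [HN H1]]]].
set (f := fun z : C => (z ^ N * k z)%C).
assert (f0 : f (RtoC 0) = 0).
{ unfold f. destruct N as [|N]; [lia|]. simpl. ring. }
assert (fC : forall z, Cmod z < R -> ccont (fun z => 1 - f z)%C z).
{ intros z Hz. apply ccont_minus; [apply ccont_const|].
  apply ccont_mult; [apply cdiff_ccont, cdiff_pow|apply HC, Hz]. }
assert (fD : forall z, Cmod z < R -> z <> 0 -> cdiff (fun z => 1 - f z)%C z).
{ intros z Hz Nz. apply cdiff_minus; [apply cdiff_const|].
  apply cdiff_mult; [apply cdiff_pow|apply HD; assumption]. }
assert (fN : forall z, Cmod z < R -> (1 - f z)%C <> 0).
{ intros z Hz. apply Cminus_neq_0. intro E. apply (H1 z Hz). symmetry. exact E. }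
set (rho := (r + R) / 2).
destruct (exists_log (fun z => 1 - f z)%C rho R) as [L [L0 HL]];
  [unfold rho; lra|exact fC|exact fN|].
set (g := fun z => cexp (L z / 2)%C).
assert (gg : forall z, Cmod z < rho -> (g z * g z = 1 - f z)%C).
{ intros z Hz. unfold g. rewrite <- cexp_plus.
  replace (L z / 2 + L z / 2)%C with (L z) by (field; intro E; injection E; lra).
  rewrite (proj1 (proj2 (HL z Hz))), f0. field. }
assert (g0 : g (RtoC 0) = 1).
{ unfold g. rewrite L0. replace (RtoC 0 / 2)%C with (RtoC 0) by (unfold Cdiv; ring).
  apply cexp_0. }
assert (LD : forall z, Cmod z < rho -> z <> 0 -> cdiff L z).
{ intros z Hz Nz. apply HL; [exact Hz|].
  apply fD; [unfold rho in Hz; lra|exact Nz]. }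
assert (gC : forall z, Cmod z < rho -> ccont (fun z => 1 + g z)%C z).
{ intros z Hz. apply ccont_plus; [apply ccont_const|].
  apply (ccont_comp (fun z => L z / 2)%C); [|apply cdiff_ccont, cdiff_cexp].
  apply ccont_mult; [apply HL, Hz|apply ccont_const]. }
assert (gD : forall z, Cmod z < rho -> z <> 0 -> cdiff (fun z => 1 + g z)%C z).
{ intros z Hz Nz. apply cdiff_plus; [apply cdiff_const|].
  apply (cdiff_comp (fun z => L z / 2)%C); [|apply cdiff_cexp].
  apply cdiff_mult; [apply LD; assumption|apply cdiff_const]. }
assert (gN : forall z, Cmod z < rho -> (1 + g z)%C <> 0).
{ intros z Hz E.
  assert (Ez : f z = 0).
  { replace (f z) with (1 - g z * g z)%C by (rewrite gg by exact Hz; ring).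
    replace (g z) with ((1 + g z) - 1)%C by ring. rewrite E. ring. }
  destruct (C_eq_dec z 0) as [->|Nz].
  - rewrite g0 in E. injection E. lra.
  - revert Ez. unfold f. apply Cmult_neq_0; [apply Cpow_nz, Nz|].
    apply HN. unfold rho in Hz. lra. }
set (u := fun z => (k z / ((1 + g z) * (1 + g z)))%C).
assert (uf : forall z, (z ^ (2 * N) * (u z * u z)
    = (f z / ((1 + g z) * (1 + g z))) * (f z / ((1 + g z) * (1 + g z))))%C).
{ intros z. unfold u, f. replace (2 * N)%nat with (N + N)%nat by lia.
  rewrite Cpow_add_r. unfold Cdiv. ring. }
assert (HO' : omits_1 rho (2 * N) (fun z => u z * u z)%C).
{ split; [lia|]. split; [|split; [|split]].
  - intros z Hz. assert (A : ccont u z).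
    { apply ccont_div; [apply HC; unfold rho in Hz; lra| |].
      - apply (ccont_mult (fun z => 1 + g z)%C (fun z => 1 + g z)%C); apply gC, Hz.
      - apply Cmult_neq_0; apply gN, Hz. }
    apply ccont_mult; exact A.
  - intros z Hz Nz. assert (A : cdiff u z).
    { apply cdiff_div; [apply HD; [unfold rho in Hz; lra|exact Nz]| |].
      - apply (cdiff_mult (fun z => 1 + g z)%C (fun z => 1 + g z)%C); apply gD; assumption.
      - apply Cmult_neq_0; apply gN, Hz. }
    apply cdiff_mult; exact A.
  - intros z Hz. assert (A : u z <> 0).
    { apply Cmult_neq_0; [apply HN; unfold rho in Hz; lra|].
      intro E. apply (f_equal (Cmult ((1 + g z) * (1 + g z))%C)) in E.
      rewrite Cinv_r in E by (apply Cmult_neq_0; apply gN, Hz).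
      rewrite Cmult_0_r in E. injection E. lra. }
    apply Cmult_neq_0; exact A.
  - intros z Hz. rewrite uf. intro E.
    assert (Nz := gN z Hz).
    replace (f z) with (1 - g z * g z)%C in E by (rewrite gg by exact Hz; ring).
    replace ((1 - g z * g z) / ((1 + g z) * (1 + g z)) *
      ((1 - g z * g z) / ((1 + g z) * (1 + g z))))%C
      with (1 - 4 * g z / ((1 + g z) * (1 + g z)))%C in E by (field; exact Nz).
    assert (E' : (4 * g z)%C = 0).
    { replace (4 * g z)%C with
        ((1 - (1 - 4 * g z / ((1 + g z) * (1 + g z)))) * ((1 + g z) * (1 + g z)))%C
        by (field; exact Nz).
      rewrite E. ring. }
    revert E'. apply Cmult_neq_0; [intro E'; injection E'; lra|apply cexp_neq_0]. }
exists rho, (fun z => u z * u z)%C.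
split; [unfold rho; lra|]. split; [exact HO'|]. split.
- unfold ln_mod, u. rewrite g0.
  assert (N0 : k (RtoC 0) <> 0) by (apply HN; rewrite Cmod_0; lra).
  assert (P0 := proj1 (Cmod_gt_0 _) N0).
  replace ((1 + 1) * (1 + 1))%C with (RtoC 4)
    by (unfold RtoC, Cplus, Cmult; simpl; f_equal; ring).
  rewrite Cmod_mult, Cmod_div by (intro E; injection E; lra).
  rewrite Cmod_R, Rabs_pos_eq by lra.
  replace 16 with (4 * 4) by ring.
  rewrite !ln_mult, !ln_div; try lra; apply Rdiv_lt_0_compat; lra.
- assert (Ex' := ex_RInt_growth r rho (2 * N) _ ltac:(unfold rho; lra) HO').
  assert (Exg : ex_RInt (fun t => 2 * ln_mod (fun z => 1 + g z)%C (circle r t)) 0 (2 * PI)).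
  { apply (ex_RInt_scal (V := R_NormedModule)), ex_RInt_circle; [lra|]. intros z Hz.
    apply continuous_ln_mod; [apply gC|apply gN]; unfold rho; lra. }
  assert (Mg : RInt (fun t => 2 * ln_mod (fun z => 1 + g z)%C (circle r t)) 0 (2 * PI)
    = RInt (fun _ => 2 * ln 2) 0 (2 * PI)).
  { rewrite (RInt_scal (V := R_CompleteNormedModule)
      (fun t => ln_mod (fun z => 1 + g z)%C (circle r t)));
      [|apply ex_RInt_circle; [lra|]; intros z Hz;
        apply continuous_ln_mod; [apply gC|apply gN]; unfold rho; lra].
    rewrite (mean_ln_mod _ r rho); [|unfold rho; lra|exact gC|exact gD|exact gN].
    rewrite RInt_const. unfold ln_mod. rewrite g0.
    replace (1 + 1)%C with (RtoC 2) by (rewrite <- RtoC_plus; f_equal; ring).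
    rewrite Cmod_R, Rabs_pos_eq by lra.
    unfold scal; simpl. unfold mult; simpl. ring. }
  assert (S : growth r (2 * N) (fun z => u z * u z)%C
      + RInt (fun t => 2 * ln_mod (fun z => 1 + g z)%C (circle r t)) 0 (2 * PI)
    <= growth r N k + RInt (fun _ => 2 * ln 2) 0 (2 * PI)).
  { assert (Exc := ex_RInt_const 0 (2 * PI) (2 * ln 2)).
    eapply Rle_trans; [right; symmetry; exact (RInt_plus _ _ _ _ Ex' Exg)|].
    eapply Rle_trans; [|right; exact (RInt_plus _ _ _ _ ExN Exc)].
    apply RInt_le; [lra| | |].
    - exact (ex_RInt_plus _ _ _ _ Ex' Exg).
    - exact (ex_RInt_plus _ _ _ _ ExN Exc).
    - intros t _. unfold plus; simpl.
      assert (Hz : Cmod (circle r t) < rho) by (rewrite Cmod_circle; unfold rho; lra).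
      change (circle r t ^ (N + (N + 0)))%C with (circle r t ^ (2 * N))%C.
      rewrite uf. apply landen_pointwise; [apply gg, Hz|apply gN, Hz]. }
  rewrite Mg in S. lra.
Qed.

(** * Hurwitz's theorem: the constant 16 *)

(** One transformation doubles both [ln |k(0)| - ln 16] and [N], and does not
    increase [growth]. *)
Lemma landen_iterate (n : nat) : forall (r R : R) (N : nat) (k : C -> C),
  0 < r < R -> omits_1 R N k ->
  2 * PI * 2 ^ n * (ln_mod k 0 - ln 16 + INR N * ln r) <= growth r N k.
Proof.
assert (Ppi := PI_RGT_0).
induction n as [|n IH]; intros r R N k Hr HO.
- assert (G := growth_bound r R N k Hr HO).
  assert (0 < ln 16) by (rewrite <- ln_1; apply ln_increasing; lra).
  simpl. nra.
- destruct (landen_step r R N k Hr HO) as [rho [k' [Hrho [HO' [E G]]]]].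
  assert (I := IH r rho (2 * N)%nat k' ltac:(lra) HO').
  rewrite E, mult_INR in I. simpl INR in I. simpl pow. 
  apply Rle_trans with (2 := G). apply Rle_trans with (2 := I). right. ring.
Qed.

(** Let [n] tend to infinity in [landen_iterate], then [r] to [1]. *)
Lemma omits_1_bound (k : C -> C) : omits_1 1 1 k -> Cmod (k 0%C) <= 16.
Proof.
intros HO.
assert (P0 : 0 < Cmod (k 0%C)).
{ apply Cmod_gt_0. apply HO. rewrite Cmod_0. lra. }
assert (Ppi := PI_RGT_0).
assert (B : forall r, 0 < r < 1 -> ln (Cmod (k 0%C)) - ln 16 + ln r <= 0).
{ intros r Hr. apply Rnot_lt_le. intros Hneg.
  set (e := ln (Cmod (k 0%C)) - ln 16 + ln r) in *.
  destruct (Pow_x_infinity 2) with (b := growth r 1 k / (2 * PI * e) + 1) as [n Hn].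
  { rewrite Rabs_pos_eq; lra. }
  specialize (Hn n (le_n n)).
  assert (A := landen_iterate n r 1 1 k Hr HO).
  unfold ln_mod in A. simpl INR in A. rewrite Rmult_1_l in A. fold e in A.
  rewrite Rabs_pos_eq in Hn by (apply pow_le; lra).
  assert (Pe : 0 < 2 * PI * e) by nra.
  assert (F : growth r 1 k / (2 * PI * e) * (2 * PI * e) = growth r 1 k) by (field; lra).
  nra. }
apply Rnot_lt_le. intros Hlt.
set (a := Cmod (k 0%C)) in *.
assert (Hq : 0 < 16 / a) by (apply Rdiv_lt_0_compat; lra).
assert (Hq1 : 16 / a < 1).
{ apply Rmult_lt_reg_r with a; [lra|]. unfold Rdiv. rewrite Rmult_assoc, Rinv_l; lra. }
(* Any [r] strictly between [16 / a] and [1] contradicts [B]. *)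
assert (L := B ((1 + 16 / a) / 2) ltac:(lra)).
assert (ln (16 / a) < ln ((1 + 16 / a) / 2)) by (apply ln_increasing; lra).
rewrite ln_div in H by lra. lra.
Qed.

(** Hurwitz's theorem: the affine map that sends [w] to [0] and [p] to [1] turns
    [f] into [z * k z] with [k 0 = a / (p - w)]. *)
Lemma hurwitz_bound (Omega : C -> Prop) (w p : C) (a : R) :
  ~ Omega p -> w <> p -> hurwitz_derivative Omega w a -> a <= 16 * Cmod (w - p).
Proof.
intros Hp Hwp [f [[Hh [HO [f0 [fN _]]]] Ha]].
destruct (Rle_lt_dec a 0) as [Hneg|Hpos].
{ assert (A := Cmod_ge_0 (w - p)). lra. }
assert (Npw : (p - w)%C <> 0) by (apply Cminus_neq_0; auto).
assert (Ppw : 0 < Cmod (p - w)) by (apply Cmod_gt_0, Npw).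
destruct (is_Cderive_quotient f 0 (RtoC a) Ha) as [q [Hq [Hq0 E]]].
assert (E' : forall z, (f z - w = q z * z)%C).
{ intros z. rewrite <- f0 at 1. rewrite E. ring. }
assert (HOm : omits_1 1 1 (fun z => q z / (p - w))%C).
{ assert (HD : forall z, Cmod z < 1 -> z <> 0 -> cdiff (fun z => q z / (p - w))%C z).
  { intros z Hz Nz. apply cdiff_mult; [|apply cdiff_const].
    destruct (Hh z Hz) as [l Hl].
    apply (cdiff_near (fun z => (f z - w) / z)%C q z (Cmod z)).
    - apply Cmod_gt_0, Nz.
    - intros v Hv. rewrite E'. field. intros ->.
      replace (0 - z)%C with (- z)%C in Hv by ring. rewrite Cmod_opp in Hv. lra.
    - apply cdiff_div; [|apply cdiff_id|exact Nz].
      apply cdiff_minus; [exact (is_Cderive_cdiff f z l Hl)|apply cdiff_const]. }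
  split; [lia|]. split; [|split; [exact HD|split]].
  - intros z Hz. destruct (C_eq_dec z 0) as [->|Nz].
    + apply ccont_mult; [exact Hq|apply ccont_const].
    + apply cdiff_ccont, HD; assumption.
  - intros z Hz. apply Cmult_neq_0.
    + destruct (C_eq_dec z 0) as [->|Nz].
      * rewrite Hq0. intro K. injection K. lra.
      * intro K. apply (fN z Hz Nz). replace (f z) with ((f z - w) + w)%C by ring.
        rewrite E', K. ring.
    + intro K. apply (f_equal (Cmult (p - w)%C)) in K. rewrite Cinv_r in K by exact Npw.
      rewrite Cmult_0_r in K. injection K. lra.
  - intros z Hz K. apply Hp.
    replace p with (f z); [apply HO, Hz|].
    replace (f z) with ((f z - w) + w)%C by ring. rewrite E'.
    replace (q z * z)%C with ((z ^ 1 * (q z / (p - w))) * (p - w))%C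
      by (simpl; field; exact Npw).
    rewrite K. ring. }
assert (B := omits_1_bound _ HOm). cbv beta in B.
rewrite Hq0, Cmod_div, Cmod_R, Rabs_pos_eq in B by (auto; lra).
replace (w - p)%C with (- (p - w))%C by ring. rewrite Cmod_opp.
apply (Rmult_le_compat_r (Cmod (p - w))) in B; [|lra].
unfold Rdiv in B. rewrite Rmult_assoc, Rinv_l in B by lra. lra.
Qed.

(** * Comparison of the two densities *)

Lemma delta_spec (Omega : C -> Prop) (w p0 : C) :
  open Omega -> Omega w -> ~ Omega p0 ->
  0 < delta Omega w /\
  (forall p, ~ Omega p -> delta Omega w <= Cmod (w - p)) /\
  (forall m, (forall p, ~ Omega p -> m <= Cmod (w - p)) -> m <= delta Omega w).
Proof.
intros Ho Hw Hp0.
destruct (proj1 (near_Cmod w Omega) (Ho w Hw)) as [e [He Hball]].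
unfold delta.
set (E := fun d => exists p : C, ~ Omega p /\ d = Cmod (w - p)%C).
destruct (Glb_Rbar_correct E) as [Hlb Hglb].
assert (Lo : Rbar_le e (Glb_Rbar E)).
{ apply Hglb. intros d [p [Hp ->]]. simpl.
  apply Rnot_lt_le. intros Hlt. apply Hp, Hball.
  replace (p - w)%C with (- (w - p))%C by ring. rewrite Cmod_opp. exact Hlt. }
assert (Up := Hlb _ (ex_intro _ p0 (conj Hp0 eq_refl))).
destruct (Glb_Rbar E) as [g| |]; simpl in Lo, Up; try contradiction.
simpl. split; [lra|]. split.
- intros p Hp. exact (Hlb _ (ex_intro _ p (conj Hp eq_refl))).
- intros m Hm. apply (Hglb (Finite m)). intros d [p [Hp ->]]. apply Hm, Hp.
Qed.

Lemma hurwitz_derivative_disk (Omega : C -> Prop) (w : C) (d : R) :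
  0 < d -> (forall z, Cmod (z - w) < d -> Omega z) -> hurwitz_derivative Omega w d.
Proof.
intros Hd HO.
assert (D : forall z, is_Cderive (fun z => w + RtoC d * z)%C z (RtoC d)).
{ intros z. split; [apply (is_linear_scal_l (V := C_NormedModule))|].
  intros x Hx eps. exists (mkposreal 1 Rlt_0_1). intros v _.
  change (Cmod (w + d * v - (w + d * x) - (v - x) * d)%C <= eps * Cmod (v - x)%C).
  replace (w + d * v - (w + d * x) - (v - x) * d)%C with (RtoC 0) by ring.
  rewrite Cmod_0. apply Rmult_le_pos; [apply Rlt_le, cond_pos|apply Cmod_ge_0]. }
assert (Nd : RtoC d <> 0) by (intro E; injection E; lra).
exists (fun z => w + RtoC d * z)%C. split; [|apply D].
split; [|split; [|split; [|split]]].
- intros z _. exists (RtoC d). apply D.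
- intros z Hz. apply HO. replace (w + d * z - w)%C with (RtoC d * z)%C by ring.
  rewrite Cmod_mult, Cmod_R, Rabs_pos_eq by lra. unfold unit_disk in Hz. nra.
- ring.
- intros s _ Ns E. apply (Cmult_neq_0 _ _ Nd Ns).
  replace (RtoC d * s)%C with ((w + RtoC d * s) - w)%C by ring. rewrite E. ring.
- exists d. split; [exact Hd|apply D].
Qed.

(** The Hurwitz radius is at most [16 * |w - w1|], and it is finite and positive,
    so that dividing by it is meaningful. *)
Lemma eta_punctured_ge (w w1 w2 : C) :
  w <> w1 -> w <> w2 -> 1 / (8 * Cmod (w - w1)) <= eta (twice_punctured w1 w2) w.
Proof.
intros N1 N2.
assert (P1 := proj1 (Cmod_gt_0 _) (Cminus_neq_0 _ _ N1)).
assert (P2 := proj1 (Cmod_gt_0 _) (Cminus_neq_0 _ _ N2)).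
set (E := hurwitz_derivative (twice_punctured w1 w2) w).
assert (Hd : E (Rmin (Cmod (w - w1)) (Cmod (w - w2)))).
{ apply hurwitz_derivative_disk; [apply Rmin_pos; assumption|].
  intros z Hz. split; intros ->; rewrite <- Cmod_opp in Hz.
  - replace (- (w1 - w))%C with (w - w1)%C in Hz by ring.
    assert (A := Rmin_l (Cmod (w - w1)) (Cmod (w - w2))). lra.
  - replace (- (w2 - w))%C with (w - w2)%C in Hz by ring.
    assert (A := Rmin_r (Cmod (w - w1)) (Cmod (w - w2))). lra. }
unfold eta, hurwitz_radius. fold E.
destruct (Lub_Rbar_correct E) as [Hub Hlub].
assert (Lo := Hub _ Hd).
assert (Up : Rbar_le (Lub_Rbar E) (16 * Cmod (w - w1))).
{ apply Hlub. intros a Ha. simpl.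
  apply (hurwitz_bound (twice_punctured w1 w2) w w1 a); [|exact N1|exact Ha].
  intros [A _]. apply A. reflexivity. }
assert (Pm := Rmin_pos _ _ P1 P2).
destruct (Lub_Rbar E) as [r| |]; simpl in Lo, Up; try contradiction.
simpl. apply Rmult_le_reg_r with (8 * Cmod (w - w1) * r); [nra|].
replace (1 / (8 * Cmod (w - w1)) * (8 * Cmod (w - w1) * r)) with r by (field; lra).
replace (2 / r * (8 * Cmod (w - w1) * r)) with (16 * Cmod (w - w1)) by (field; lra).
exact Up.
Qed.

(** The disk of radius [d] about [w] gives a member of the Hurwitz family with
    derivative [d]. *)
Lemma eta_le (Omega : C -> Prop) (w : C) (d : R) :
  0 < d -> (forall z, Cmod (z - w) < d -> Omega z) -> eta Omega w <= 2 / d.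
Proof.
intros Hd HO.
assert (Lo := proj1 (Lub_Rbar_correct (hurwitz_derivative Omega w)) _
  (hurwitz_derivative_disk Omega w d Hd HO)).
unfold eta, hurwitz_radius.
destruct (Lub_Rbar (hurwitz_derivative Omega w)) as [r| |]; simpl in Lo; try contradiction.
- simpl. apply Rmult_le_compat_l; [lra|]. apply Rinv_le_contravar; assumption.
(* An infinite supremum has real value 0, and 2 / 0 = 0. *)
- simpl. unfold Rdiv. rewrite Rinv_0, Rmult_0_r.
  apply Rmult_le_pos; [lra|apply Rlt_le, Rinv_0_lt_compat, Hd].
Qed.

Theorem theorem5p1 :
  forall Omega : C -> Prop, hyperbolic_domain Omega ->
  forall w : C, Omega w ->
    Rbar_le (Finite (1 / (8 * delta Omega w))) (eta_bar Omega w) /\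
    Rbar_le (eta_bar Omega w) (Finite (2 / delta Omega w)).
Proof.
intros Omega [[_ [Ho _]] [a [b [Nab [Ha Hb]]]]] w Hw.
destruct (delta_spec Omega w a Ho Hw Ha) as [Pd [Hlow Hinf]].
assert (Nw : forall p, ~ Omega p -> w <> p) by (intros p Hp ->; contradiction).
unfold eta_bar. match goal with |- context [Lub_Rbar ?e] => set (E := e) end.
destruct (Lub_Rbar_correct E) as [Hub Hlub].
split.
- assert (K : forall p, ~ Omega p ->
    Rbar_le (1 / (8 * Cmod (w - p))) (Lub_Rbar E)).
  { intros p Hp.
    assert (Q : exists q, p <> q /\ ~ Omega q).
    { destruct (C_eq_dec p a) as [->|N]; [exists b|exists a]; auto. }
    destruct Q as [q [Npq Hq]].
    apply Rbar_le_trans with (eta (twice_punctured p q) w).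
    - apply eta_punctured_ge; apply Nw; assumption.
    - apply Hub. exists p, q. auto. }
  destruct (Lub_Rbar E) as [m| |]; [|exact I|exact (K a Ha)].
  simpl in K |- *.
  assert (Pp : forall p, ~ Omega p -> 0 < Cmod (w - p))
    by (intros p Hp; apply Cmod_gt_0, Cminus_neq_0, Nw, Hp).
  assert (Pm : 0 < m).
  { apply Rlt_le_trans with (2 := K a Ha). apply Rdiv_lt_0_compat; [lra|].
    specialize (Pp a Ha). lra. }
  assert (D : 1 / (8 * m) <= delta Omega w).
  { apply Hinf. intros p Hp. specialize (Pp p Hp). specialize (K p Hp).
    apply (Rmult_le_compat_r (Cmod (w - p) / m)) in K;
      [|apply Rlt_le, Rdiv_lt_0_compat; lra].
    replace (1 / (8 * Cmod (w - p)) * (Cmod (w - p) / m)) with (1 / (8 * m)) in K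
      by (field; lra).
    replace (m * (Cmod (w - p) / m)) with (Cmod (w - p)) in K by (field; lra).
    exact K. }
  apply (Rmult_le_compat_r (m / delta Omega w)) in D;
    [|apply Rlt_le, Rdiv_lt_0_compat; lra].
  replace (1 / (8 * m) * (m / delta Omega w)) with (1 / (8 * delta Omega w)) in D
    by (field; lra).
  replace (delta Omega w * (m / delta Omega w)) with m in D by (field; lra).
  exact D.
- apply Hlub. intros y [w1 [w2 [_ [H1 [H2 ->]]]]]. simpl.
  apply eta_le; [exact Pd|]. intros z Hz.
  rewrite <- Cmod_opp in Hz. replace (- (z - w))%C with (w - z)%C in Hz by ring.
  split; intros ->.
  + specialize (Hlow w1 H1). lra.
  + specialize (Hlow w2 H2). lra.
Qed.
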